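(* Let $M$ be a connected matroid. The following are equivalent. (i) $M$ has the symmetric strong circuit elimination property (SSCE); (ii) $M$ has no pair of skew circuits; (iii) for all integers $k\ge 3$ and $l\ge 3$, $M$ has no series minor isomorphic to the series connection $S(U_{k-2,k},U_{l-2,l})$; (iv) $M^*$ is unbreakable.
   Context: A matroid $M$ has the symmetric strong circuit elimination property (SSCE) if, whenever $C_1$ and $C_2$ are circuits of $M$ and $e_1,e_2,e$ are elements with $e_1\in C_1-C_2$, $e_2\in C_2-C_1$ and $e\in C_1\cap C_2$, there is a circuit $C_3$ of $M$ with $\{e_1,e_2\}\subseteq C_3\subseteq (C_1\cup C_2)-e$. Two sets $X,Y$ in a matroid with rank function $r$ are skew if $r(X)+r(Y)=r(X\cup Y)$; a pair of skew circuits is a pair of distinct circuits that are skew. $U_{r,n}$ denotes the uniform matroid of rank $r$ on $n$ elements. Series connection: if $M_1,M_2$ are matroids with $E(M_1)\cap E(M_2)=\{p\}$ and $p$ is neither a loop nor a coloop of either, then $S((M_1;p),(M_2;p))$ (also written $S(M_1,M_2)$) is the matroid on $E(M_1)\cup E(M_2)$ whose circuits are the circuits of $M_1$ avoiding $p$, the circuits of $M_2$ avoiding $p$, and all sets $C_1\cup C_2$ where $C_i$ is a circuit of $M_i$ containing $p$ for $i=1,2$. (For uniform $M_1,M_2$ the choice of basepoint does not matter up to isomorphism.) A series contraction of $M$ is the contraction $M/f$ of an element $f$ for which there is $g$ with $\{f,g\}$ a cocircuit of $M$; a matroid $N$ is a series minor of $M$ if $N$ can be obtained from $M$ by a sequence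 of deletions and series contractions. A matroid $M$ is unbreakable if $M$ is connected and $M/F$ is connected for every flat $F$ of $M$. *)

(* Defs.v *)
From mathcomp Require Import all_boot.
Set Implicit Arguments.
Unset Strict Implicit.
Unset Printing Implicit Defensive.

Record mat (T : finType) := Mat { ground : {set T}; circ : {set {set T}} }.

Section MatroidDefs.
Variable T : finType.
Implicit Types (M : mat T) (X Y C D F B : {set T}) (e f g : T).

Definition is_matroid M : Prop :=
  [/\ forall C, C \in circ M -> C \subset ground M,
      set0 \notin circ M,
      forall C1 C2, C1 \in circ M -> C2 \in circ M -> C1 \subset C2 -> C1 = C2 &
      forall C1 C2 e, C1 \in circ M -> C2 \in circ M -> C1 != C2 ->
        e \in C1 :&: C2 ->
        exists2 C3, C3 \in circ M & C3 \subset (C1 :|: C2) :\ e].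

Definition indep M X : bool :=
  (X \subset ground M) && [forall C in circ M, ~~ (C \subset X)].

Definition rank M X : nat :=
  \max_(I : {set T} | (I \subset X) && indep M I) #|I|.

Definition is_basis M B : bool :=
  indep M B && [forall e in ground M :\: B, ~~ indep M (e |: B)].

Definition cocircuits M : {set {set T}} :=
  [set D | minset (fun D : {set T} => [&& D != set0, D \subset ground M &
            [forall B : {set T}, is_basis M B ==> (D :&: B != set0)]]) D].

Definition dual M : mat T := Mat (ground M) (cocircuits M).

Definition cocircuit M D : bool := D \in cocircuits M.

Definition delete M e : mat T :=
  Mat (ground M :\ e) [set C in circ M | e \notin C].

Definition contract M X : mat T :=
  Mat (ground M :\: X)
      [set D | minset (fun D : {set T} =>
                 (D != set0) && [exists C in circ M, D == C :\: X]) D].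

Definition skew M X Y : Prop := rank M X + rank M Y = rank M (X :|: Y).

Definition has_skew_circuits M : Prop :=
  exists C1 C2, [/\ C1 \in circ M, C2 \in circ M, C1 != C2 & skew M C1 C2].

Definition SSCE M : Prop :=
  forall C1 C2 e1 e2 e, C1 \in circ M -> C2 \in circ M ->
    e1 \in C1 :\: C2 -> e2 \in C2 :\: C1 -> e \in C1 :&: C2 ->
    exists2 C3, C3 \in circ M &
      (e1 \in C3) && (e2 \in C3) && (C3 \subset (C1 :|: C2) :\ e).

Definition connected M : Prop :=
  forall e f, e \in ground M -> f \in ground M -> e != f ->
    exists2 C, C \in circ M & (e \in C) && (f \in C).

Definition is_flat M F : bool :=
  (F \subset ground M) &&
  [forall e in ground M :\: F, rank M F < rank M (e |: F)].

Definition unbreakable M : Prop :=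
  connected M /\ forall F, is_flat M F -> connected (contract M F).

Inductive series_minor : mat T -> mat T -> Prop :=
| sm_refl M : series_minor M M
| sm_del N M e : e \in ground M -> series_minor N (delete M e) -> series_minor N M
| sm_scon N M f g : f != g -> cocircuit M [set f; g] ->
    series_minor N (contract M [set f]) -> series_minor N M.

End MatroidDefs.

Definition isomorphic (T T' : finType) (M : mat T) (N : mat T') : Prop :=
  exists f : T -> T',
    [/\ {in ground M &, injective f}, f @: ground M = ground N &
        forall X : {set T}, X \subset ground M -> (X \in circ M) = (f @: X \in circ N)].

Definition uniform (r n : nat) : mat 'I_n :=
  Mat [set: 'I_n] [set X : {set 'I_n} | #|X| == r.+1].

(* series connection S((M1;p1),(M2;p2)), realised on T1 + T2 with p2
   identified with p1 (inl p1) *)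
Definition series_conn (T1 T2 : finType) (M1 : mat T1) (M2 : mat T2)
    (p1 : T1) (p2 : T2) : mat (T1 + T2)%type :=
  let g := fun x : T2 => if x == p2 then @inl T1 T2 p1 else inr x in
  Mat (@inl T1 T2 @: ground M1 :|: g @: ground M2)
      ([set @inl T1 T2 @: C | C : {set T1} in circ M1 & p1 \notin C]
       :|: [set g @: C | C : {set T2} in circ M2 & p2 \notin C]
       :|: [set (@inl T1 T2 @: C1) :|: (g @: C2)
              | C1 : {set T1} in circ M1, C2 : {set T2} in circ M2 & (p1 \in C1) && (p2 \in C2)]).

(* Main.v *)
Require Import Defs.
From mathcomp Require Import all_boot.
Set Implicit Arguments.
Unset Strict Implicit.
Unset Printing Implicit Defensive.

(** Distinct circuits [C1], [C2] are skew iff they are disjoint and are the only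
    circuits inside their union. If no such pair exists, any union of circuits
    is connected. As the complements of the flats of the dual are exactly the
    unions of circuits, this is unbreakability of the dual; combined with strong
    circuit elimination, it also gives SSCE.
    Skew pairs lift through deletions and series contractions, and the series
    connection of two uniform matroids of corank 2 has one. Conversely, let [C1],
    [C2] be skew and let [D] be a circuit meeting both with
    [P := D :\: (C1 :|: C2)] as small as possible. In the restriction to
    [C1 :|: C2 :|: D] every circuit other than [C1], [C2] contains [P], and its
    complements in [C1] and [C2] are series classes that can be prescribed
    independently; contracting the series classes to single elements leaves
    exactly such a series connection. *)

(** * Circuits, rank and cocircuits *)

Lemma subset_at (T : finType) (A B : {set T}) : A \subset B ->
  forall z, (z \in A) ==> (z \in B).
Proof. by move=> sAB z; apply/implyP; apply: (subsetP sAB). Qed.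

Ltac case_members :=
  rewrite ?inE ?eqxx /=; try done;
  repeat (match goal with
  | |- context [?x \in ?A] => case: (x \in A)
  end; rewrite /= ?andbT ?andbF ?orbT ?orbF /=; try done).

(* Decides set inclusions that follow pointwise from the inclusions in the
   context, together with the memberships of the singled-out elements. *)
Ltac set_sub :=
  let z := fresh "z" in apply/subsetP => z; apply: contraTT;
  repeat match goal with
  | H : is_true (_ \subset _) |- _ => move: {H} (subset_at H z)
  end;
  rewrite ?inE;
  repeat match goal with
  | |- context [z == ?x] => case: (eqVneq z x) => [?|_]; [subst z|]
  end;
  repeat match goal with
  | H : is_true (?x \in _) |- context [?x \in _] => move: H
  | H : is_true (?x \notin _) |- context [?x \in _] => move: H
  end;
  case_members.

Section Basics.
Context {T : finType}.
Implicit Types (M : mat T) (A B C D F I J R X Y Z : {set T}) (e f g x y : T).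

Lemma circ_sub M C : is_matroid M -> C \in circ M -> C \subset ground M.
Proof. by case=> + _ _ _; apply. Qed.

Lemma circ_nonempty M C : is_matroid M -> C \in circ M -> exists x, x \in C.
Proof. by case=> _ m0 _ _ cC; apply/set0Pn; apply: contraNneq m0 => <-. Qed.

Lemma circ_antichain M C1 C2 : is_matroid M -> C1 \in circ M ->
  C2 \in circ M -> C1 \subset C2 -> C1 = C2.
Proof. by case=> _ _ + _; apply. Qed.

Lemma circ_diff M C1 C2 : is_matroid M -> C1 \in circ M -> C2 \in circ M ->
  C1 != C2 -> exists2 x, x \in C1 & x \notin C2.
Proof.
move=> mM c1 c2 ne12; apply/subsetPn; apply: contra_neqN ne12.
exact: circ_antichain mM c1 c2.
Qed.

Lemma weak_elim M C1 C2 e : is_matroid M -> C1 \in circ M -> C2 \in circ M ->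
  C1 != C2 -> e \in C1 -> e \in C2 ->
  exists2 C3, C3 \in circ M & C3 \subset (C1 :|: C2) :\ e.
Proof.
by case=> _ _ _ mE c1 c2 ne e1 e2; apply: (mE C1 C2 e) => //; rewrite inE e1.
Qed.

(** Induction on the size of the union. If weak elimination yields a [C3] missing [f], pick [g] in
    [C3] outside [C1], hence in [C2]. Eliminating [g] between [C2] and [C3] while keeping [e] gives
    [C4], since that union lacks [f]; eliminating [e] between [C1] and [C4] while keeping [f] then
    works, since that union lacks [g]. *)
Lemma strong_elim M C1 C2 e f : is_matroid M -> C1 \in circ M ->
  C2 \in circ M -> e \in C1 -> e \in C2 -> f \in C1 -> f \notin C2 ->
  exists C3, [/\ C3 \in circ M, f \in C3 & C3 \subset (C1 :|: C2) :\ e].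
Proof.
move=> mM.
elim: {C1 C2}_.+1 {-2}C1 {-2}C2 (ltnSn #|C1 :|: C2|) e f => // n IH C1 C2.
rewrite ltnS => len e f c1 c2 e1 e2 f1 f2.
have ne12 : C1 != C2 by apply: contraNneq f2 => <-.
have [C3 c3 s3] := weak_elim mM c1 c2 ne12 e1 e2.
have [f3|f3] := boolP (f \in C3); first by exists C3.
have e3 : e \notin C3 by apply/negP => /(subsetP s3); rewrite !inE eqxx.
have ne31 : C3 != C1 by apply: contraNneq f3 => ->.
have [g g3 g1] := circ_diff mM c3 c1 ne31.
have g2 : g \in C2 by move: (subsetP s3 g g3); rewrite !inE (negPf g1) => /andP[].
have [C4 [c4 e4 s4]] : exists C4,
    [/\ C4 \in circ M, e \in C4 & C4 \subset (C2 :|: C3) :\ g].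
  apply: IH => //; apply: leq_trans len; apply: proper_card.
  apply/properP; split.
    by set_sub.
  by exists f; rewrite !inE ?f1 // negb_or f2.
have f4 : f \notin C4.
  by apply/negP => /(subsetP s4); rewrite !inE (negPf f2) (negPf f3) andbF.
have g4 : g \notin C4 by apply/negP => /(subsetP s4); rewrite !inE eqxx.
have [C5 [c5 f5 s5]] : exists C5,
    [/\ C5 \in circ M, f \in C5 & C5 \subset (C1 :|: C4) :\ e].
  apply: IH => //; apply: leq_trans len; apply: proper_card.
  apply/properP; split; [set_sub|exists g; rewrite !inE ?g2 ?orbT //].
  by rewrite negb_or g1.
by exists C5; split => //; set_sub.
Qed.

(** Induction on the size of the union. Eliminating a common [e] gives [C3] through [x] and [C4]
    through [y], both avoiding [e]. If [C3] omits some [w] of [C1 :\: C2], the pair [C3], [C2] has a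
    smaller union; otherwise [C3] meets [C4] inside [C1 :\: C2], and their union lacks [e]. *)
Lemma circ_trans M C1 C2 x y : is_matroid M -> C1 \in circ M ->
  C2 \in circ M -> x \in C1 -> y \in C2 -> C1 :&: C2 != set0 ->
  exists C3, [/\ C3 \in circ M, x \in C3, y \in C3 & C3 \subset C1 :|: C2].
Proof.
move=> mM.
elim: {C1 C2}_.+1 {-2}C1 {-2}C2 (ltnSn #|C1 :|: C2|) => // n IH C1 C2.
rewrite ltnS => len c1 c2 x1 y2 /set0Pn[e]; rewrite inE => /andP[e1 e2].
have [x2|x2] := boolP (x \in C2).
  by exists C2; split => //; apply: subsetUr.
have [y1|y1] := boolP (y \in C1).
  by exists C1; split => //; apply: subsetUl.
have [C3 [c3 x3 s3]] := strong_elim mM c1 c2 e1 e2 x1 x2.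
have [C4 [c4 y4 s4]] := strong_elim mM c2 c1 e2 e1 y2 y1.
have e3 : e \notin C3 by apply/negP => /(subsetP s3); rewrite !inE eqxx.
have e4 : e \notin C4 by apply/negP => /(subsetP s4); rewrite !inE eqxx.
have ne31 : C3 != C1 by apply: contraNneq e3 => ->.
have [g g3 g1] := circ_diff mM c3 c1 ne31.
have g2 : g \in C2 by move: (subsetP s3 g g3); rewrite !inE (negPf g1) => /andP[].
have ne42 : C4 != C2 by apply: contraNneq e4 => ->.
have [h h4 h2] := circ_diff mM c4 c2 ne42.
have h1 : h \in C1.
  by move: (subsetP s4 h h4); rewrite !inE (negPf h2) => /andP[].
have sub A B w : A :|: B \subset C1 :|: C2 -> w \in C1 :|: C2 ->
    w \notin A :|: B -> A \in circ M -> B \in circ M -> x \in A -> y \in B ->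
    A :&: B != set0 -> exists C3, [/\ C3 \in circ M, x \in C3, y \in C3
      & C3 \subset C1 :|: C2].
  move=> sAB w12 wAB cA cB xA yB meet.
  have [|C [cC xC yC sC]] := IH A B _ cA cB xA yB meet.
    by apply: leq_trans len; apply: proper_card; apply/properP; split=> //; exists w.
  by exists C; split => //; apply: subset_trans sC sAB.
have meet32 : C3 :&: C2 != set0 by apply/set0Pn; exists g; rewrite inE g3.
have [s13|] := boolP (C1 :\: C2 \subset C3); last first.
  case/subsetPn=> w; rewrite inE => /andP[w2 w1] w3.
  apply: (sub C3 C2 w) => //; rewrite ?inE ?w1 ?negb_or ?w3 //; set_sub.
apply: (sub C3 C4 e) => //; rewrite ?inE ?e1 ?negb_or ?e3 ?e4 //; first by set_sub.
by apply/set0Pn; exists h; rewrite inE h4 (subsetP s13) // inE h2.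
Qed.

(** * Independent sets and the rank function *)

Lemma indepP M X : reflect (X \subset ground M /\
  forall C, C \in circ M -> ~~ (C \subset X)) (indep M X).
Proof.
apply: (iffP andP) => -[sX H]; split => //; first exact/forall_inP.
exact/forall_inP.
Qed.

Lemma indepS M X Y : Y \subset X -> indep M X -> indep M Y.
Proof.
move=> sYX /indepP[sX H]; apply/indepP; split; first exact: subset_trans sX.
by move=> C /H; apply: contra => /subset_trans; apply.
Qed.

Lemma depP M X : X \subset ground M -> ~~ indep M X ->
  exists2 C, C \in circ M & C \subset X.
Proof.
by rewrite /indep => -> /=; case/forall_inPn=> C cC; rewrite negbK; exists C.
Qed.

(* Among the independent subsets of [I :|: J] larger than [I], one omitting as
   little of [I] as possible must contain [I]. *)
Lemma indep_aug M I J : is_matroid M -> indep M I -> indep M J ->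
  #|I| < #|J| -> exists2 x, x \in J :\: I & indep M (x |: I).
Proof.
move=> mM iI iJ ltIJ.
pose P (K : {set T}) := [&& K \subset I :|: J, indep M K & #|I| < #|K|].
have PJ : P J by rewrite /P subsetUr iJ.
case: (arg_minnP (fun K : {set T} => #|I :\: K|) PJ).
move=> K /and3P[sK iK ltK] minK.
have [sIK|] := boolP (I \subset K).
  have /subsetPn[x xK xI] : ~~ (K \subset I).
    by apply: contraL ltK => /subset_leq_card; rewrite -leqNgt.
  exists x; last by apply: indepS iK; rewrite subUset sub1set xK.
  by move: (subsetP sK x xK); rewrite !inE (negPf xI).
case/subsetPn=> e eI eK; exfalso.
have noK C : C \in circ M -> C \subset K -> False.
  by move=> cC; apply/negP; case/indepP: iK => _; apply.
have noI C : C \in circ M -> C \subset I -> False.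
  by move=> cC; apply/negP; case/indepP: iI => _; apply.
(* Swapping [f] for [e] in [K] keeps the size and omits less of [I], so the result is dependent. Two
   such circuits, for [g] and for an [h] in the first one, are distinct; eliminating [e] between
   them leaves a circuit inside the independent [K]. *)
have exC f : f \in K -> f \notin I ->
    exists C, [/\ C \in circ M, e \in C & C \subset (e |: K) :\ f].
  move=> fK fI; have nef : e != f by apply: contraNneq fI => <-.
  have: ~~ P ((e |: K) :\ f).
    apply/negP => /minK; apply/negP; rewrite -ltnNge; apply: proper_card.
    apply/properP; split; last by exists e; rewrite !inE ?eqxx ?eI ?eK ?nef.
    by set_sub.
  have sTf : (e |: K) :\ f \subset I :|: J by set_sub.
  have cT : #|(e |: K) :\ f| = #|K|.
    have := cardsD1 f (e |: K); rewrite cardsU1 eK !inE fK orbT.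
    by move=> /eqP; rewrite eqSS => /eqP.
  rewrite /P sTf cT ltK andbT /= => /depP[|C cC sC].
    apply: subset_trans sTf _.
    by case/andP: iI => + _; case/andP: iJ => + _; move=> *; set_sub.
  exists C; split => //; apply: contraT => eC; case: (noK C cC); set_sub.
have /subsetPn[g gK gI] : ~~ (K \subset I).
  by apply: contraL ltK => /subset_leq_card; rewrite -leqNgt.
have [Cg [cg eg sg]] := exC g gK gI.
have /subsetPn[h hg hI] : ~~ (Cg \subset I) by apply/negP => /(noI _ cg).
have hK : h \in K.
  have ne_he : h != e by apply: contraNneq hI => ->.
  by move: (subsetP sg h hg); rewrite !inE (negPf ne_he) => /andP[].
have [Ch [ch eh sh]] := exC h hK hI.
have hh : h \notin Ch by apply/negP => /(subsetP sh); rewrite !inE eqxx.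
have ne : Cg != Ch by apply: contraNneq hh => <-.
have [C cC sC] := weak_elim mM cg ch ne eg eh.
by apply: (noK C cC); set_sub.
Qed.

Lemma indep0 M : is_matroid M -> indep M set0.
Proof.
move=> mM; apply/indepP; split; first exact: sub0set.
move=> C cC; rewrite subset0.
by apply: contraTneq cC => ->; case: mM.
Qed.

Lemma indep_extend M I X : I \subset X -> indep M I ->
  exists J, [/\ I \subset J, J \subset X, indep M J &
    forall x, x \in X -> x \notin J -> ~~ indep M (x |: J)].
Proof.
move=> sIX iI; pose P (J : {set T}) := (J \subset X) && indep M J.
have PI : P I by rewrite /P sIX.
have [J /maxsetP[/andP[sJ iJ] maxJ] sIJ] := maxset_exists PI.
exists J; split => // x xX; apply: contra => ixJ.
rewrite -(maxJ (x |: J)) ?setU11 ?subsetUr // /P ixJ andbT.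
by rewrite subUset sub1set xX.
Qed.

Lemma rank_ub M I X : I \subset X -> indep M I -> #|I| <= rank M X.
Proof.
move=> sI iI; rewrite /rank.
apply: (@leq_bigmax_cond _ (fun I : {set T} => (I \subset X) && indep M I)
  (fun I : {set T} => #|I|) I).
by rewrite sI.
Qed.

Lemma rank_witness M X : is_matroid M ->
  exists I, [/\ I \subset X, indep M I & #|I| = rank M X].
Proof.
pose P := [pred I : {set T} | (I \subset X) && indep M I].
move=> mM; have [|I /andP[sI iI] rI] := @eq_bigmax_cond _ P (fun I : {set T} => #|I|).
  by apply/card_gt0P; exists set0; rewrite inE sub0set indep0.
by exists I; rewrite sI iI -rI.
Qed.

Lemma maximal_indep_card M I X : is_matroid M -> I \subset X -> indep M I ->
  (forall x, x \in X -> x \notin I -> ~~ indep M (x |: I)) -> #|I| = rank M X.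
Proof.
move=> mM sI iI maxI; apply/eqP; rewrite eqn_leq rank_ub //= leqNgt.
have [J [sJ iJ <-]] := rank_witness X mM.
apply/negP => /(indep_aug mM iI iJ)[x]; rewrite inE => /andP[xI xJ].
by apply/negP; apply: maxI => //; apply: (subsetP sJ).
Qed.

Lemma dep_circ M C X : C \in circ M -> C \subset X -> ~~ indep M X.
Proof. by move=> cC sC; apply/negP => /indepP[_ /(_ C cC)]; rewrite sC. Qed.

Lemma circ_sub_indep M C1 C2 e : is_matroid M -> C1 \in circ M ->
  C2 \in circ M -> e \in C1 -> C2 \subset C1 :\ e -> False.
Proof.
move=> mM c1 c2 e1 s21; have eqC : C2 = C1.
  by apply: circ_antichain mM c2 c1 _; set_sub.
by move: (subsetP s21 e); rewrite eqC e1 !inE eqxx => /(_ isT).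
Qed.

Lemma circ_del_indep M C e : is_matroid M -> C \in circ M -> e \in C ->
  indep M (C :\ e).
Proof.
move=> mM cC eC; apply/indepP; split.
  by apply: subset_trans (circ_sub mM cC); apply: subsetDl.
by move=> D cD; apply/negP; apply: circ_sub_indep mM cC cD eC.
Qed.

(** Extend [D :\ e] to a maximal independent subset [I] of [F]. As [e |: I] contains [D], the set
    [I] is still maximal in [e |: F]. *)
Lemma rank_span M D F e : is_matroid M -> D \in circ M -> e \in D ->
  D \subset e |: F -> rank M (e |: F) = rank M F.
Proof.
move=> mM cD eD sD.
have iDe := circ_del_indep mM cD eD.
have sDF : D :\ e \subset F by set_sub.
have [I [sDI sIF iI maxI]] := indep_extend sDF iDe.
rewrite -(maximal_indep_card mM sIF iI maxI); apply/esym.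
apply: maximal_indep_card => // [|x]; first by set_sub.
case/setU1P=> [-> _|]; last exact: maxI.
by apply: dep_circ cD _; set_sub.
Qed.

(** A rank-free form of skewness for distinct circuits, justified by [skew_pairP]; it is what the
    rest of the development manipulates. *)
Definition skew_pair M C1 C2 : Prop :=
  [/\ C1 \in circ M, C2 \in circ M, [disjoint C1 & C2] &
    forall C, C \in circ M -> C \subset C1 :|: C2 -> C = C1 \/ C = C2].

Lemma circ_rank M C : is_matroid M -> C \in circ M -> (rank M C).+1 = #|C|.
Proof.
move=> mM cC; have [e eC] := circ_nonempty mM cC.
rewrite (cardsD1 e) eC add1n; congr _.+1; apply/esym.
apply: maximal_indep_card => //; [exact: subsetDl|exact: circ_del_indep|].
move=> x xC; rewrite !inE xC andbT negbK => /eqP->.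
by apply: dep_circ cC _; rewrite setD1K.
Qed.

Lemma rank_leq_card M X : rank M X <= #|X|.
Proof. by apply/bigmax_leqP => I /andP[/subset_leq_card]. Qed.

Lemma rank_setU M X Y : is_matroid M -> rank M (X :|: Y) <= rank M X + rank M Y.
Proof.
move=> mM; have [I [sI iI <-]] := rank_witness (X :|: Y) mM.
have <- : (I :&: X) :|: (I :&: Y) = I by rewrite -setIUr; apply/setIidPl.
apply: leq_trans (leq_card_setU _ _) _; apply: leq_add.
  by apply: rank_ub (subsetIr _ _) _; apply: indepS iI; apply: subsetIl.
by apply: rank_ub (subsetIr _ _) _; apply: indepS iI; apply: subsetIl.
Qed.

(** Without [y] and [z], only [rank M C2 - 1] elements of [C2] remain, too few for the ranks to add
    up. *)
Lemma skew_lt M C1 C2 y z : is_matroid M -> C1 \in circ M -> C2 \in circ M ->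
  y \in C2 -> z \in C2 -> y != z ->
  rank M (C1 :|: C2) <= rank M (C1 :|: (C2 :\ y :\ z)) -> ~ skew M C1 C2.
Proof.
move=> mM c1 c2 y2 z2 neyz le sk.
have := leq_trans le (rank_setU _ _ mM); rewrite -sk leq_add2l.
move=> /leq_trans/(_ (rank_leq_card _ _)); rewrite leqNgt => /negP; apply.
have := circ_rank mM c2;
  rewrite (cardsD1 y C2) y2 (cardsD1 z (C2 :\ y)) !inE eq_sym neyz z2.
by move=> [->].
Qed.

(** A common element, or a third circuit in the union, allows two elements of [C2] to be dropped
    without loss of rank, against [skew_lt]. Conversely, deleting one element from each circuit
    leaves an independent set of size [rank M C1 + rank M C2]. *)
Lemma skew_pairP M C1 C2 : is_matroid M -> C1 \in circ M -> C2 \in circ M ->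
  C1 != C2 -> skew M C1 C2 <-> skew_pair M C1 C2.
Proof.
move=> mM c1 c2 ne12; split=> [sk|[_ _ dis12 only12]].
  have span C y : C \in circ M -> y \in C -> C \subset C1 :|: C2 ->
      y \in C2 -> y \notin C1 -> rank M (C1 :|: C2) = rank M (C1 :|: (C2 :\ y)).
    move=> cC yC sC y2 y1.
    have -> : C1 :|: C2 = y |: (C1 :|: (C2 :\ y)).
      by rewrite setUCA setD1K.
    by apply: rank_span mM cC yC _; set_sub.
  have [y y2 y1] : exists2 y, y \in C2 & y \notin C1.
    by apply: circ_diff mM c2 c1 _; rewrite eq_sym.
  have dis : [disjoint C1 & C2].
    apply/pred0P => e; apply/negbTE/negP => /= /andP[e1 e2].
    have ne_ye : y != e by apply: contraNneq y1 => ->.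
    apply: (skew_lt mM c1 c2 y2 e2 ne_ye) sk.
    rewrite (span C2 y) ?subsetUr //; apply: eq_leq; congr (rank M _).
    by apply/setP => z; rewrite !inE; case: (eqVneq z e) => [->|]; rewrite ?e1.
  split=> // C cC sC.
  have [->|ne1] := eqVneq C C1; first by left.
  have [->|ne2] := eqVneq C C2; first by right.
  exfalso.
  (* Two elements are dropped in turn: [w] is spanned through [C2], and then [z] through [C], which
     does not contain [w]. *)
  have [z zC z1] := circ_diff mM cC c1 ne1.
  have z2 : z \in C2 by move: (subsetP sC z zC); rewrite inE (negPf z1).
  have [w w2 wC] : exists2 w, w \in C2 & w \notin C.
    by apply: circ_diff mM c2 cC _; rewrite eq_sym.
  have w1 : w \notin C1 by rewrite (disjointFl dis).
  have ne_wz : w != z by apply: contraNneq wC => ->.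
  apply: (skew_lt mM c1 c2 w2 z2 ne_wz) sk.
  rewrite (span C2 w) ?subsetUr //.
  have -> : C1 :|: C2 :\ w = z |: (C1 :|: C2 :\ w :\ z).
    by rewrite setUCA setD1K // !inE eq_sym ne_wz.
  rewrite (rank_span mM cC zC) //; apply/subsetP => u uC.
  move: (subsetP sC u uC); rewrite !inE => /orP[->|->]; rewrite ?orbT //.
  by case: (eqVneq u w) uC wC => [->->|] //=; case: (u == z) => //=; rewrite orbT.
apply/eqP; rewrite eqn_leq rank_setU // andbT.
have [x1 x1C] := circ_nonempty mM c1; have [x2 x2C] := circ_nonempty mM c2.
have := circ_rank mM c1; have := circ_rank mM c2.
rewrite (cardsD1 x1 C1) (cardsD1 x2 C2) x1C x2C => -[->] [->].
have disD : (C1 :\ x1) :&: (C2 :\ x2) = set0.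
  by apply/eqP; rewrite setI_eq0; apply: disjointW dis12; apply: subsetDl.
rewrite -cardsUI disD cards0 addn0; apply: rank_ub.
  by rewrite setUSS ?subsetDl.
apply/indepP; split.
  apply: (subset_trans (setUSS (subsetDl _ _) (subsetDl _ _))).
  by rewrite subUset !circ_sub.
move=> C cC; apply/negP => sC.
have x12 : x1 \notin C2 by rewrite (disjointFr dis12).
have x21 : x2 \notin C1 by rewrite (disjointFl dis12).
have sC12 : C \subset C1 :|: C2.
  by apply: subset_trans sC _; rewrite setUSS ?subsetDl.
have x1N : x1 \notin C by apply/negP => /(subsetP sC);
  rewrite !inE eqxx (negPf x12) andbF.
have x2N : x2 \notin C by apply/negP => /(subsetP sC);
  rewrite !inE eqxx (negPf x21) andbF.
by case: (only12 C cC sC12) => eqC; [rewrite eqC x1C in x1N|rewrite eqC x2C in x2N].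
Qed.

(** Disjoint circuits that are not a skew pair have a third circuit in their union. It meets both,
    so [circ_trans] applied twice leads from [x] to [y]. *)
Lemma no_skew_connected M C1 C2 x y : is_matroid M ->
  (forall D1 D2, ~ skew_pair M D1 D2) -> C1 \in circ M -> C2 \in circ M ->
  x \in C1 -> y \in C2 ->
  exists C, [/\ C \in circ M, x \in C, y \in C & C \subset C1 :|: C2].
Proof.
move=> mM nosk c1 c2 x1 y2.
have [dis|meet] := eqVneq (C1 :&: C2) set0; last exact: circ_trans.
have [/exists_inP[C cC /and3P[sC ne1 ne2]]|none] :=
  boolP [exists C in circ M, [&& C \subset C1 :|: C2, C != C1 & C != C2]].
  have [z zC z1] := circ_diff mM cC c1 ne1.
  have z2 : z \in C2 by move: (subsetP sC z zC); rewrite inE (negPf z1).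
  have [w wC w2] := circ_diff mM cC c2 ne2.
  have w1 : w \in C1 by move: (subsetP sC w wC); rewrite inE (negPf w2) orbF.
  have meet1 : C1 :&: C != set0 by apply/set0Pn; exists w; rewrite inE w1.
  have [D [cD xD zD sD]] := circ_trans mM c1 cC x1 zC meet1.
  have meet2 : D :&: C2 != set0 by apply/set0Pn; exists z; rewrite inE zD.
  have [E [cE xE yE sE]] := circ_trans mM cD c2 xD y2 meet2.
  by exists E; split=> //; set_sub.
case: (nosk C1 C2); split=> //; first by rewrite -setI_eq0 dis.
move=> C cC sC; have [->|ne1] := eqVneq C C1; first by left.
have [->|ne2] := eqVneq C C2; first by right.
by case/exists_inP: none; exists C; rewrite ?sC ?ne1.
Qed.

(** * Bases, cocircuits and duality *)

Lemma basisP M B : reflect (indep M B /\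
    forall x, x \in ground M -> x \notin B -> ~~ indep M (x |: B)) (is_basis M B).
Proof.
apply: (iffP andP) => -[iB maxB]; split=> //.
  by move=> x xE xB; apply: (forall_inP maxB); rewrite inE xB.
by apply/forall_inP => x; rewrite inE => /andP[xB xE]; apply: maxB.
Qed.

Lemma basis_extend M I : indep M I -> exists2 B, is_basis M B & I \subset B.
Proof.
move=> iI; have [|B [sIB _ iB maxB]] := @indep_extend M I (ground M) _ iI.
  by case/indepP: iI.
by exists B => //; apply/basisP; split.
Qed.

Lemma basis_max_card M I B : is_matroid M -> indep M I -> is_basis M B ->
  #|I| <= #|B|.
Proof.
move=> mM iI /basisP[iB maxB]; rewrite leqNgt; apply/negP => ltBI.
have [x] := indep_aug mM iB iI ltBI; rewrite inE => /andP[xB xI].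
by apply/negP; apply: maxB xB; apply: (subsetP _ _ xI); case/indepP: iI.
Qed.

Lemma basis_of_card M I B : is_matroid M -> indep M I -> is_basis M B ->
  #|B| <= #|I| -> is_basis M I.
Proof.
move=> mM iI bB leBI; apply/basisP; split=> // x _ xI; apply/negP => ixI.
by have := basis_max_card mM ixI bB; rewrite cardsU1 xI add1n leqNgt ltnS leBI.
Qed.

Lemma cocirc_sub M D : D \in cocircuits M -> D \subset ground M.
Proof. by rewrite inE => /minsetP[/and3P[]]. Qed.

Lemma cocirc_neq0 M D : D \in cocircuits M -> D != set0.
Proof. by rewrite inE => /minsetP[/and3P[]]. Qed.

Lemma cocirc_basis M D B : D \in cocircuits M -> is_basis M B -> D :&: B != set0.
Proof.
by rewrite inE => /minsetP[/and3P[_ _ /forallP/(_ B)/implyP]] + _; apply.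
Qed.

Lemma cocirc_antichain M D1 D2 : D1 \in cocircuits M -> D2 \in cocircuits M ->
  D1 \subset D2 -> D1 = D2.
Proof. by rewrite !inE => /minsetP[p1 _] /minsetP[_]; apply. Qed.

Lemma cocirc_exists M X : is_matroid M -> X \subset ground M ->
  (forall B, is_basis M B -> X :&: B != set0) ->
  exists2 D, D \in cocircuits M & D \subset X.
Proof.
move=> mM sX meetX.
pose P (D : {set T}) := [&& D != set0, D \subset ground M &
  [forall B : {set T}, is_basis M B ==> (D :&: B != set0)]].
have PX : P X.
  rewrite /P sX; apply/andP; split; last first.
    by apply/forallP => B; apply/implyP => /meetX.
  have [B /meetX + _] := basis_extend (indep0 mM).
  by apply: contra => /eqP->; rewrite set0I.
by have [D mD sD] := minset_exists PX; exists D; rewrite ?inE.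
Qed.

Lemma cocirc_min M D X : is_matroid M -> D \in cocircuits M -> X \subset D ->
  X != D -> exists2 B, is_basis M B & X :&: B = set0.
Proof.
move=> mM dD sX neX.
have [/existsP[B /andP[bB /eqP eB]]|none] :=
  boolP [exists B, is_basis M B && (X :&: B == set0)]; first by exists B.
have [||D' dD' sD'] := @cocirc_exists M X mM.
- exact: subset_trans (cocirc_sub dD).
- move=> B bB; apply: contraNneq none => eB.
  by apply/existsP; exists B; rewrite bB eB eqxx.
case/eqP: neX; apply/eqP; rewrite eqEsubset sX.
by rewrite -(cocirc_antichain dD' dD (subset_trans sD' sX)).
Qed.

(** If [C] met [D] only in [e], then [C :\ e] would extend to a maximal independent set [I] avoiding
    [D]. By minimality of [D] some basis [B] avoids [D :\ e]. Neither [e] (because of [C]) nor any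
    other element of [B] can be added to [I], so [I] is a basis missing [D], a contradiction. *)
Lemma orthogonality M C D e : is_matroid M -> C \in circ M ->
  D \in cocircuits M -> e \in C -> e \in D ->
  exists f, [/\ f \in C, f \in D & f != e].
Proof.
move=> mM cC dD eC eD.
have [/existsP[f /and3P[fC fD fe]]|none] :=
  boolP [exists f, [&& f \in C, f \in D & f != e]]; first by exists f.
exfalso.
have [||B bB meetB] := @cocirc_min M D (D :\ e) mM dD; first exact: subsetDl.
  by apply: contraTneq eD => <-; rewrite !inE eqxx.
have sI : C :\ e \subset ground M :\: D.
  apply/subsetP => z; rewrite !inE => /andP[ze zC].
  rewrite (subsetP (circ_sub mM cC)) // andbT.
  by apply: contra none => zD; apply/existsP; exists z; rewrite zC zD.
have [I [sCI sID iI maxI]] := indep_extend sI (circ_del_indep mM cC eC).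
have bI : is_basis M I.
  apply: (basis_of_card mM iI bB); rewrite leqNgt; apply/negP => ltIB.
  have iB : indep M B by case/basisP: bB.
  have [x] := indep_aug mM iI iB ltIB; rewrite inE => /andP[xI xB] ixI.
  have [xe|ne_xe] := eqVneq x e.
    move: ixI; apply/negP; apply: dep_circ cC _.
    by rewrite xe -(setD1K eC) setUS.
  have xD : x \notin D.
    by apply/negP => xD; move/setP/(_ x): meetB; rewrite !inE ne_xe xD xB.
  move: ixI; apply/negP; apply: maxI xI; rewrite inE xD.
  by apply: (subsetP _ _ xB); case/indepP: iB.
have /set0Pn[z] := cocirc_basis dD bI; rewrite inE => /andP[zD zI].
by move: (subsetP sID z zI); rewrite inE zD.
Qed.

(* Minty's painting lemma. *)
Lemma painting M R e : is_matroid M -> e \in ground M -> R \subset ground M ->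
  e \notin R ->
  (exists C, [/\ C \in circ M, e \in C & C \subset e |: R]) \/
  (exists D, [/\ D \in cocircuits M, e \in D & [disjoint D & R]]).
Proof.
move=> mM eE sR eR.
have [/exists_inP[C cC /andP[eC sC]]|noC] :=
  boolP [exists C in circ M, (e \in C) && (C \subset e |: R)].
  by left; exists C.
right.
have [I [_ sIR iI maxI]] := indep_extend (sub0set R) (indep0 mM).
have eI : e \notin I by apply: contra eR; apply: (subsetP sIR).
have ieI : indep M (e |: I).
  apply/indepP; split; first by rewrite subUset sub1set eE (subset_trans sIR).
  move=> C cC; apply: contra noC => sC; apply/exists_inP; exists C => //.
  rewrite (subset_trans sC) ?setUS // andbT; apply: contraT => eC.
  case/indepP: iI => _ /(_ C cC)/negP[]; set_sub.
have [B bB sB] := basis_extend ieI; have iB : indep M B by case/basisP: bB.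
have eB : e \in B by apply: (subsetP sB); rewrite setU11.
(* This is the fundamental cocircuit of [e] with respect to [B]. It meets [B] only in [e], so any
   cocircuit inside it contains [e]. *)
pose S := [set x in ground M | (x \notin B :\ e) && indep M (x |: (B :\ e))].
have sS : S \subset ground M by apply/subsetP => x; rewrite inE => /andP[].
have [B' bB'|D dD sD] := cocirc_exists mM sS.
  have iB' : indep M B' by case/basisP: bB'.
  have lt : #|B :\ e| < #|B'|.
    have := basis_max_card mM iB bB'; rewrite (cardsD1 e B) eB; exact.
  have [x] := indep_aug mM (indepS (subsetDl B [set e]) iB) iB' lt.
  rewrite inE => /andP[xB xB'] ixB; apply/set0Pn; exists x.
  rewrite !inE xB' ixB !andbT; apply/andP; split; last by rewrite !inE in xB.
  by apply: (subsetP _ _ xB'); case/indepP: iB'.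
exists D; split=> //.
  have /set0Pn[z] := cocirc_basis dD bB; rewrite inE => /andP[zD zB].
  move: (subsetP sD z zD); rewrite !inE zB andbT negbK.
  by case: (eqVneq z e) => [<-|]; rewrite ?andbF.
apply/pred0P => z; apply/negbTE/negP => /= /andP[zD zR].
move: (subsetP sD z zD); rewrite inE => /and3P[_ zB iz].
have IBe : I \subset B :\ e by set_sub.
have zI : z \notin I by apply: contra zB; apply: (subsetP IBe).
move: (maxI z zR zI); rewrite (indepS _ iz) //.
by rewrite setUS.
Qed.

(** Cocircuit elimination comes from painting at an [f] of [D1] outside [D2], with [R] the
    complement of [D1 :|: D2] plus [e]. A circuit through [f] inside [f |: R] would meet [D1] again,
    necessarily at [e], and would then meet [D2] in [e] alone. The remaining alternative is a
    cocircuit inside [(D1 :|: D2) :\ e]. *)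
Lemma dual_matroid M : is_matroid M -> is_matroid (dual M).
Proof.
move=> mM; split=> /=; first exact: cocirc_sub.
- by apply/negP => /cocirc_neq0; rewrite eqxx.
- exact: cocirc_antichain.
move=> D1 D2 e d1 d2 ne12; rewrite inE => /andP[e1 e2].
have [f f1 f2] : exists2 f, f \in D1 & f \notin D2.
  by apply/subsetPn; apply: contra_neqN ne12; apply: cocirc_antichain d1 d2.
have fE := subsetP (cocirc_sub d1) f f1.
have ne_fe : f != e by apply: contraNneq f2 => ->.
pose R := ground M :\: (D1 :|: D2) :|: [set e].
have [||[C [cC fC sC]]|[D [dD fD dis]]] := @painting M R f mM fE.
- rewrite /R subUset subsetDl sub1set.
  exact: (subsetP (cocirc_sub d1)).
- by rewrite !inE f1 (negPf ne_fe).
- have [g [gC g1 gf]] := orthogonality mM cC d1 fC f1.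
  have ge : g = e.
    move: (subsetP sC g gC); rewrite !inE (negPf gf) g1 /=.
    by move/eqP.
  subst g; have [h [hC h2 he]] := orthogonality mM cC d2 gC e2.
  have hf : h != f by apply: contraNneq f2 => <-.
  by move: (subsetP sC h hC); rewrite !inE (negPf hf) (negPf he) h2 orbT.
exists D => //; apply/subsetP => z zD.
have zE := subsetP (cocirc_sub dD) z zD.
by move: (disjointFr dis zD); rewrite !inE zE andbT => /negbT;
  rewrite negb_or negbK andbC.
Qed.

End Basics.

(** * SSCE, skew circuits and flats of the dual *)

Section Equivalences.
Context {T : finType}.
Implicit Types (M N : mat T) (A B C D F I J P R X Y Z : {set T}) (e f g x y : T).

Lemma skew_circuits_pair M : is_matroid M ->
  has_skew_circuits M <-> exists C1 C2, skew_pair M C1 C2.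
Proof.
move=> mM; split=> [[C1 [C2 [c1 c2 ne sk]]]|[C1 [C2 sk]]]; exists C1, C2.
  exact/skew_pairP.
case: (sk) => c1 c2 dis _; have [x x1] := circ_nonempty mM c1.
have ne : C1 != C2.
  by apply/eqP => eqC; move: (disjointFr dis x1); rewrite -eqC x1.
by split=> //; apply/skew_pairP.
Qed.

(* Take a circuit [D] meeting both circuits with as few elements outside their
   union as possible. Exchanging within each circuit gives [D1] and [D2] that
   share an outside element, and eliminating it beats the minimality of [D]. *)
Lemma SSCE_no_skew M C1 C2 : is_matroid M -> connected M -> SSCE M ->
  ~ skew_pair M C1 C2.
Proof.
move=> mM conM ssce [c1 c2 dis only].
have [x1 x1C] := circ_nonempty mM c1; have [x2 x2C] := circ_nonempty mM c2.
have x12 : x1 \notin C2 by rewrite (disjointFr dis).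
have [D0 d0 /andP[x1D x2D]] : exists2 D, D \in circ M & (x1 \in D) && (x2 \in D).
  apply: conM; [exact: (subsetP (circ_sub mM c1))|exact: (subsetP (circ_sub mM c2))|].
  by apply: contraNneq x12 => ->.
pose P (D : {set T}) := [&& D \in circ M, D :&: C1 != set0 & D :&: C2 != set0].
have P0 : P D0.
  by rewrite /P d0 /=; apply/andP; split; apply/set0Pn; [exists x1|exists x2];
    rewrite inE ?x1D ?x2D.
case: (arg_minnP (fun D : {set T} => #|D :\: (C1 :|: C2)|) P0).
move=> D /and3P[cD /set0Pn[a1]]; rewrite inE => /andP[a1D a1C].
case/set0Pn=> a2; rewrite inE => /andP[a2D a2C] minD.
have a12 : a1 \notin C2 by rewrite (disjointFr dis).
have a21 : a2 \notin C1 by rewrite (disjointFl dis).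
have out C y z : C \in circ M -> y \in C -> y \in C1 -> z \in C -> z \in C2 ->
    ~~ (C \subset C1 :|: C2).
  move=> cC yC y1 zC z2; apply/negP => /(only C cC)[] eqC; subst C.
    by move: (disjointFr dis zC); rewrite z2.
  by move: (disjointFr dis y1); rewrite yC.
have /subsetPn[f fD fN] := out D a1 a2 cD a1D a1C a2D a2C.
(* A circuit inside [C1 :|: C2 :|: D] that meets both circuits but misses [f] has fewer outside
   elements than [D]. *)
have full C y z : C \in circ M -> y \in C -> y \in C1 -> z \in C -> z \in C2 ->
    C \subset C1 :|: C2 :|: D -> f \in C.
  move=> cC yC y1 zC z2 sC; have pC : P C.
    by rewrite /P cC /=; apply/andP; split; apply/set0Pn; [exists y|exists z];
      rewrite inE ?yC ?zC.
  apply: contraT => fC; have := minD C pC; rewrite leqNgt => /negP[].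
  apply: proper_card; apply/properP; split; last by exists f;
    rewrite !inE ?fD -?in_setU ?fN // negb_and fC orbT.
  by set_sub.
have neD1 : D != C1 by apply: contraNneq a21 => <-.
have neD2 : D != C2 by apply: contraNneq a12 => <-.
have [b1 b1C b1D] : exists2 b, b \in C1 & b \notin D.
  by apply: circ_diff mM c1 cD _; rewrite eq_sym.
have [b2 b2C b2D] : exists2 b, b \in C2 & b \notin D.
  by apply: circ_diff mM c2 cD _; rewrite eq_sym.
have [D1 d1 /andP[/andP[b1D1 a2D1] s1]] : exists2 C3, C3 \in circ M &
    (b1 \in C3) && (a2 \in C3) && (C3 \subset (C1 :|: D) :\ a1).
  by apply: ssce => //; rewrite !inE ?b1D ?a21 ?a1C.
have [D2 d2 /andP[/andP[b2D2 a1D2] s2]] : exists2 C3, C3 \in circ M &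
    (b2 \in C3) && (a1 \in C3) && (C3 \subset (C2 :|: D) :\ a2).
  by apply: ssce => //; rewrite !inE ?b2D ?a12 ?a2C.
have f1 : f \in D1 by apply: (full D1 b1 a2) => //; set_sub.
have f2 : f \in D2 by apply: (full D2 a1 b2) => //; set_sub.
have a1D1 : a1 \notin D1 by apply/negP => /(subsetP s1); rewrite !inE eqxx.
have a2D2 : a2 \notin D2 by apply/negP => /(subsetP s2); rewrite !inE eqxx.
(* Here [a2] belongs only to [D1] and [a1] only to [D2], so SSCE can remove [f] and keep both; [D3]
   then contradicts [full]. *)
have [D3 d3 /andP[/andP[a2D3 a1D3] s3]] : exists2 C3, C3 \in circ M &
    (a2 \in C3) && (a1 \in C3) && (C3 \subset (D1 :|: D2) :\ f).
  by apply: ssce => //; rewrite !inE ?f1 ?a2D2 ?a1D1.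
have: f \in D3 by apply: (full D3 a1 a2) => //; set_sub.
by move/(subsetP s3); rewrite !inE eqxx.
Qed.

(** Strong elimination retains [e1] and [e2] in two separate circuits avoiding [e];
    [no_skew_connected] joins them inside their union. *)
Lemma no_skew_SSCE M : is_matroid M ->
  (forall C1 C2, ~ skew_pair M C1 C2) -> SSCE M.
Proof.
move=> mM nosk C1 C2 e1 e2 e c1 c2; rewrite !inE.
case/andP=> e12 e11 /andP[e21 e22] /andP[eC1 eC2].
have [D1 [d1 e1D s1]] := strong_elim mM c1 c2 eC1 eC2 e11 e12.
have [D2 [d2 e2D s2]] := strong_elim mM c2 c1 eC2 eC1 e22 e21.
have [C [cC e1C e2C sC]] := no_skew_connected mM nosk d1 d2 e1D e2D.
by exists C => //; rewrite e1C e2C; set_sub.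
Qed.

(** * Flats and contractions of the dual *)

(** Flats of the dual are the complements of unions of circuits. By orthogonality, a circuit through
    [e] avoiding [F] keeps [e] out of the dual closure of [F]. Without such a circuit, painting
    gives a cocircuit through [e] inside [e |: F], and [e] does not raise the dual rank. *)
Lemma dual_flatP M F : is_matroid M -> F \subset ground M ->
  reflect (forall e, e \in ground M -> e \notin F ->
             exists C, [/\ C \in circ M, e \in C & [disjoint C & F]])
          (is_flat (dual M) F).
Proof.
move=> mM sF; have mD := dual_matroid mM.
rewrite /is_flat /= sF; apply: (iffP forall_inP) => flatF e; last first.
  rewrite inE => /andP[eF eE]; have [C [cC eC dis]] := flatF e eE eF.
  have [I [sI iI <-]] := rank_witness F mD.
  have eI : e \notin I by apply: contra eF; apply: (subsetP sI).
  have -> : #|I|.+1 = #|e |: I| by rewrite cardsU1 eI.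
  apply: rank_ub; first exact: setUS.
  case/indepP: iI => sIE noI; apply/indepP; split; first by rewrite subUset sub1set eE.
  move=> D dD; apply: contra (noI D dD) => sD.
  have [eD|eD] := boolP (e \in D); last first.
    by set_sub.
  have [f [fC fD fe]] := orthogonality mM cC dD eC eD.
  move: (subsetP sD f fD); rewrite !inE (negPf fe) /= => /(subsetP sI).
  by rewrite (disjointFr dis fC).
move=> eE eF; pose R := ground M :\: (e |: F).
have [||[C [cC eC sC]]|[D [dD eD dis]]] := @painting T M R e mM eE.
- exact: subsetDl.
- by rewrite !inE eqxx.
- exists C; split=> //; apply/pred0P => z; apply/negbTE/negP => /= /andP[zC zF].
  move: (subsetP sC z zC); rewrite !inE zF orbT /= orbF => /eqP ze.
  by rewrite -ze zF in eF.
have := flatF e; rewrite inE eF eE => /(_ isT).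
rewrite (rank_span mD dD eD) ?ltnn //.
apply/subsetP => z zD; have zE := subsetP (cocirc_sub dD) z zD.
by move: (disjointFr dis zD); rewrite !inE zE andbT => /negbFE.
Qed.

Lemma contract_dualP M F D : is_matroid M ->
  reflect [/\ D != set0, exists2 D0, D0 \in cocircuits M & D = D0 :\: F &
     forall D', D' \in cocircuits M -> D' :\: F != set0 -> D' :\: F \subset D ->
       D' :\: F = D]
  (D \in circ (contract (dual M) F)).
Proof.
move=> mM; rewrite inE.
apply: (iffP minsetP) => [[/andP[D0 /exists_inP[D1 d1 /eqP eD]] minD]|].
  split=> // [|D' d' ne sD]; first by exists D1.
  by apply: minD => //; rewrite ne; apply/exists_inP; exists D'.
case=> D0 [D1 d1 eD] minD; split.
  by rewrite D0; apply/exists_inP; exists D1 => //; apply/eqP.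
by move=> B /andP[B0 /exists_inP[D' d' /eqP eB]]; rewrite eB in B0 *; apply: minD.
Qed.

(** Given a circuit [C] through [e] and [f] avoiding [F], consider the cocircuits through [e] that
    meet [C] inside [[set e; f]]; by orthogonality they contain [f]. One with fewest elements
    outside [F] has a minimal trace there, hence gives a circuit of the contraction. *)
Lemma connected_contract_dual M F : is_matroid M ->
  (forall e f, e \in ground M :\: F -> f \in ground M :\: F -> e != f ->
    exists C, [/\ C \in circ M, e \in C, f \in C & [disjoint C & F]]) ->
  connected (contract (dual M) F).
Proof.
move=> mM conM e f eX fX ne_ef.
have [C [cC eC fC dis]] := conM e f eX fX ne_ef.
have eE : e \in ground M by move: eX; rewrite /= inE => /andP[].
have eF : e \notin F by move: eX; rewrite /= inE => /andP[].
have fF : f \notin F by move: fX; rewrite /= inE => /andP[].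
have mD := dual_matroid mM.
pose P (D : {set T}) := [&& D \in cocircuits M, e \in D & D :&: C \subset [set e; f]].
have withf D : P D -> f \in D.
  case/and3P=> dD eD sD; have [g [gC gD ne]] := orthogonality mM cC dD eC eD.
  have: g \in D :&: C by rewrite inE gD.
  by move/(subsetP sD); rewrite !inE (negPf ne) => /eqP <-.
have [D0 P0] : exists D, P D.
  (* The circuit alternative would lie inside [C :\ f]. *)
  have [||[C' [cC' eC' sC']]|[D [dD eD disD]]] :=
    @painting T M (C :\ e :\ f) e mM eE.
  - by apply: subset_trans (circ_sub mM cC); apply: subset_trans (subsetDl _ _);
    apply: subsetDl.
  - by rewrite !inE eqxx andbF.
  - case: (circ_sub_indep mM cC cC' fC).
    apply/subsetP => z /(subsetP sC'); rewrite !inE.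
    by case/orP=> [/eqP->|/and3P[-> _ ->]] //; rewrite ne_ef.
  exists D; rewrite /P dD eD; apply/subsetP => z; rewrite !inE => /andP[zD zC].
  by move: (disjointFr disD zD); rewrite !inE zC andbT => /negbT;
    rewrite negb_and !negbK orbC.
case: (arg_minnP (fun D : {set T} => #|D :\: F|) P0) => D PD minD.
case/and3P: (PD) => dD eD sD.
exists (D :\: F); last by rewrite !inE eF fF eD withf.
apply/contract_dualP => //; split; [by apply/set0Pn; exists e; rewrite inE eF|
  by exists D|].
move=> D' dD' /set0Pn[z]; rewrite inE => /andP[zF zD'] sD'.
have subD w : w \notin F -> w \in D' -> w \in D.
  by move=> wF wD'; have := subsetP sD' w; rewrite !inE wF wD' => /(_ isT).
have zD : z \in D := subD z zF zD'.
have sDC : D' :&: C \subset [set e; f].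
  apply/subsetP => w; rewrite inE => /andP[wD' wC].
  have wF : w \notin F by rewrite (disjointFr dis wC).
  by apply: (subsetP sD); rewrite inE wC andbT subD.
have [eD'|eD'] := boolP (e \in D').
  have PD' : P D' by rewrite /P dD' eD'.
  by apply/eqP; rewrite eqEcard sD' minD.
have [D3 [d3 e3 s3]] := @strong_elim T (dual M) D D' z e mD dD dD' zD zD' eD eD'.
(* A competitor [D'] missing [e] must avoid [C] altogether. Hence the cocircuit [D3], obtained by
   removing [z] from [D] and [D'] while keeping [e], still satisfies [P], and it has fewer elements
   outside [F]. *)
have fD' : f \notin D'.
  apply/negP => fD'; have [g [gC gD' ne]] := orthogonality mM cC dD' fC fD'.
  have: g \in D' :&: C by rewrite inE gD'.
  by move/(subsetP sDC); rewrite !inE (negPf ne) orbF => /eqP ge;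
    rewrite ge (negPf eD') in gD'.
have dis' w : w \in C -> w \notin D'.
  move=> wC; apply/negP => wD'; have: w \in D' :&: C by rewrite inE wD'.
  by move/(subsetP sDC); rewrite !inE => /orP[] /eqP ew;
    rewrite ew ?(negPf eD') ?(negPf fD') in wD'.
have P3 : P D3.
  rewrite /P d3 e3; apply/subsetP => w; rewrite inE => /andP[wD3 wC].
  apply: (subsetP sD); rewrite inE wC andbT.
  by move: (subsetP s3 w wD3); rewrite !inE (negPf (dis' w wC)) orbF => /andP[].
have := minD D3 P3; rewrite leqNgt => /negP[]; apply: proper_card.
apply/properP; split; last first.
  exists z; rewrite inE zF //=; apply/negP => /(subsetP s3).
  by rewrite !inE eqxx.
apply/subsetP => w; rewrite !inE => /andP[wF /(subsetP s3)].
by rewrite !inE wF => /andP[_ /orP[//|]]; apply: subD.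
Qed.

Lemma no_skew_unbreakable M : is_matroid M -> connected M ->
  (forall C1 C2, ~ skew_pair M C1 C2) -> unbreakable (dual M).
Proof.
move=> mM conM nosk; split=> [e f eE fE ne|F flatF].
  (* Connectedness of the dual itself is the case of contracting the empty set. *)
  have: connected (contract (dual M) set0).
    apply: connected_contract_dual => // x y; rewrite !setD0 => xE yE nexy.
    have [C cC /andP[xC yC]] := conM x y xE yE nexy.
    by exists C; split=> //; rewrite disjoint_sym disjoints_subset sub0set.
  move=> /(_ e f); rewrite /= setD0 => /(_ eE fE ne)[D dD efD].
  exists D => //; move/contract_dualP: dD => /(_ mM)[_ [D0 d0 ->] _].
  by rewrite setD0.
have sF : F \subset ground M by case/andP: flatF.
move/(dual_flatP mM sF) in flatF.
apply: connected_contract_dual => // x y; rewrite !inE.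
case/andP=> xF xE /andP[yF yE] _.
have [C1 [c1 x1 dis1]] := flatF x xE xF.
have [C2 [c2 y2 dis2]] := flatF y yE yF.
have [C [cC xC yC sC]] := no_skew_connected mM nosk c1 c2 x1 y2.
exists C; split=> //; apply: disjointWl sC _.
by rewrite -setI_eq0 setIUl setU_eq0 !setI_eq0 dis1 dis2.
Qed.

(** The complement [F] of [C1 :|: C2] is a flat of the dual. A circuit [D] of the contraction
    through [x1] in [C1] contains a second element [c] of [C1], and minimality reduces it to these
    two, so it cannot reach [C2]. *)
Lemma unbreakable_no_skew M C1 C2 : is_matroid M -> unbreakable (dual M) ->
  ~ skew_pair M C1 C2.
Proof.
move=> mM [_ unb] [c1 c2 dis only].
pose X := C1 :|: C2; pose F := ground M :\: X.
have sX : X \subset ground M by rewrite subUset !circ_sub.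
have XF z : z \in ground M -> (z \notin F) = (z \in X).
  by move=> zE; rewrite inE zE andbT negbK.
have flatF : is_flat (dual M) F.
  apply/dual_flatP => //; first exact: subsetDl.
  move=> e eE; rewrite XF // => eX.
  have disF C : C \subset X -> [disjoint C & F].
    by move=> sC; rewrite disjoints_subset setCD subsetU // sC orbT.
  case/setUP: eX => eC; [exists C1|exists C2]; split=> //; apply: disF.
    exact: subsetUl.
  exact: subsetUr.
have [x1 x1C] := circ_nonempty mM c1; have [x2 x2C] := circ_nonempty mM c2.
have x12 : x1 \notin C2 by rewrite (disjointFr dis).
have x21 : x2 \notin C1 by rewrite (disjointFl dis).
have ne12 : x1 != x2 by apply: contraNneq x12 => ->.
have eqX : ground M :\: F = X by rewrite setDDr setDv set0U; apply/setIidPr.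
have [||D dD /andP[x1D x2D]] := unb F flatF x1 x2 _ _ ne12.
- by rewrite /= eqX inE x1C.
- by rewrite /= eqX inE x2C orbT.
move/contract_dualP: dD => /(_ mM)[_ [D0 d0 eD] minD].
have x1D0 : x1 \in D0 by move: x1D; rewrite eD inE => /andP[].
have [c [cC cD ne]] := orthogonality mM c1 d0 x1C x1D0.
have x1E := subsetP (circ_sub mM c1) x1 x1C.
have cE := subsetP (circ_sub mM c1) c cC.
(* No circuit inside [X] contains [x1] but not [c], since [C1] and [C2] are the only circuits there.
   Painting therefore gives a cocircuit whose trace on [X] lies in [[set x1; c]]. *)
have [||[C [cC' eC' sC']]|[D' [d' x1D' dis']]] :=
  @painting T M (X :\ x1 :\ c) x1 mM x1E.
- by apply: subset_trans sX; apply: subset_trans (subsetDl _ _); apply: subsetDl.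
- by rewrite !inE eqxx andbF.
- have cN : c \notin C.
    by apply/negP => /(subsetP sC'); rewrite !inE eqxx (negPf ne).
  have [|eqC|eqC] := only C cC'.
  + apply/subsetP => z /(subsetP sC'); rewrite !inE.
    by case/orP=> [/eqP->|/and3P[_ _ ->]] //; rewrite x1C.
  + by rewrite eqC cC in cN.
  + by rewrite eqC (negPf x12) in eC'.
have only' z : z \in D' :\: F -> z = x1 \/ z = c.
  rewrite inE => /andP[zF zD']; have zE := subsetP (cocirc_sub d') z zD'.
  rewrite XF // in zF; move: (disjointFr dis' zD'); rewrite !inE.
  move: zF; rewrite inE => -> /=; rewrite andbT.
  by case: (eqVneq z c) => [->|_]; [right|case: eqP => // ->; left].
have eqD : D' :\: F = D.
  apply: minD => //; first by apply/set0Pn; exists x1; rewrite inE x1D' XF // inE x1C.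
  apply/subsetP => z /only'[]->//.
  by rewrite eD inE cD XF // inE cC.
move: x2D; rewrite -eqD => /only'[] eq2.
  by rewrite eq2 eqxx in ne12.
by rewrite eq2 cC in x21.
Qed.
End Equivalences.

(** * Skew circuits and series minors *)

Section SeriesMinors.
Context {T : finType}.
Implicit Types (M N : mat T) (A B C D F I J P R X Y Z : {set T}) (a b e f g x y : T).

Lemma delete_matroid M e : is_matroid M -> is_matroid (delete M e).
Proof.
move=> mM; split=> /=.
- by move=> C; rewrite inE => /andP[cC eC]; rewrite subsetD1 eC circ_sub.
- by rewrite inE; case: mM => _ /negPf-> _ _.
- by move=> C D; rewrite !inE => /andP[cC _] /andP[cD _];
  apply: circ_antichain mM cC cD.
move=> C D x; rewrite !inE => /andP[cC eC] /andP[cD eD] ne /andP[xC xD].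
have [C3 c3 s3] := weak_elim mM cC cD ne xC xD; exists C3 => //.
rewrite inE c3; apply/negP => /(subsetP s3).
by rewrite !inE (negPf eC) (negPf eD) andbF.
Qed.

Lemma delete_skew_pair M e C1 C2 : skew_pair (delete M e) C1 C2 ->
  skew_pair M C1 C2.
Proof.
case; rewrite !inE => /andP[c1 e1] /andP[c2 e2] dis only; split=> // C cC sC.
apply: (only _ _ sC); rewrite inE cC; apply/negP => /(subsetP sC).
by rewrite inE (negPf e1) (negPf e2).
Qed.

Lemma skew_pair_delete M e C1 C2 : e \notin C1 -> e \notin C2 ->
  skew_pair M C1 C2 -> skew_pair (delete M e) C1 C2.
Proof.
move=> e1 e2 [c1 c2 dis only]; split; rewrite ?inE ?c1 ?c2 //.
by move=> C; rewrite inE => /andP[cC _]; apply: only.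
Qed.

(** * Series pairs and series contraction *)

(** The circuit form of [[set f; g]] being a cocircuit. It also holds for two elements in no
    circuit, whence the circuit through [f] required by [in_series_cocircuit]. *)
Definition in_series M f g : bool :=
  (f != g) && [forall C in circ M, (f \in C) == (g \in C)].

Lemma in_seriesP M f g : reflect (f != g /\
  forall C, C \in circ M -> (f \in C) = (g \in C)) (in_series M f g).
Proof.
apply: (iffP andP) => -[ne H]; split=> //.
  by move=> C /(forall_inP H)/eqP.
by apply/forall_inP => C /H->.
Qed.

Lemma cocircuit_in_series M f g : is_matroid M -> f != g ->
  cocircuit M [set f; g] -> in_series M f g.
Proof.
move=> mM ne cofg; apply/in_seriesP; split=> // C cC.
have half x y : x \in [set f; g] -> y \in [set f; g] -> x != y -> x \in C -> y \in C.
  move=> xfg yfg nexy xC; have [z [zC zfg nezx]] := orthogonality mM cC cofg xC xfg.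
  suff -> : y = z by [].
  move: zfg xfg yfg nezx nexy; rewrite !inE.
  by move=> /orP[] /eqP-> /orP[] /eqP-> /orP[] /eqP->; rewrite ?eqxx.
by apply/idP/idP; apply: half; rewrite ?set21 ?set22 // eq_sym.
Qed.

(** A basis missing [f] contains [g], because the circuit that [f] closes with it contains [g].
    Neither element suffices alone: deleting one of them from [C] leaves an independent set, which
    extends to a basis missing that element. *)
Lemma in_series_cocircuit M C f g : is_matroid M -> in_series M f g ->
  C \in circ M -> f \in C -> cocircuit M [set f; g].
Proof.
move=> mM /in_seriesP[ne ser] cC fC; have gC : g \in C by rewrite -ser.
have sub := subsetP (circ_sub mM cC).
have sE : [set f; g] \subset ground M by rewrite subUset !sub1set !sub.
have [|D dD sD] := cocirc_exists mM sE.
  move=> B /basisP[iB maxB]; apply/set0Pn.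
  have [fB|fB] := boolP (f \in B); first by exists f; rewrite inE set21.
  have sfB : f |: B \subset ground M.
    by rewrite subUset sub1set sub //=; case/indepP: iB.
  have [C' cC' sC'] := depP sfB (maxB f (sub f fC) fB).
  have fC' : f \in C'.
    apply: contraT => fC'; case/indepP: iB => _ /(_ C' cC')/negP[].
    by set_sub.
  exists g; rewrite inE set22; move: (subsetP sC' g); rewrite -ser // fC'.
  by rewrite !inE eq_sym (negPf ne) => /(_ isT).
suff <- : D = [set f; g] by [].
have inD x y : [set f; g] = [set x; y] -> x != y -> x \in C -> y \in D.
  move=> eqfg nexy xC.
  have [B bB sB] := basis_extend (circ_del_indep mM cC xC).
  have xB : x \notin B.
    apply/negP => xB; have: indep M B by case/basisP: bB.
    by apply/negP/(dep_circ cC); rewrite -(setD1K xC) subUset sub1set xB.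
  have /set0Pn[z] := cocirc_basis dD bB; rewrite inE => /andP[zD zB].
  move: (subsetP sD z zD); rewrite eqfg !inE => /orP[] /eqP ez; last by rewrite -ez.
  by rewrite ez (negPf xB) in zB.
apply/eqP; rewrite eqEsubset sD subUset !sub1set (inD f g) // (inD g f) //.
  by rewrite setUC.
by rewrite eq_sym.
Qed.

Lemma setD1_sub_series f g A B : f != g -> (f \in A) = (g \in A) ->
  (f \in B) = (g \in B) -> A :\ f \subset B :\ f -> A \subset B.
Proof.
move=> ne fA fB sAB; apply/subsetP => z zA; have [zf|nez] := eqVneq z f.
  have gA : g \in A by rewrite -fA -zf.
  by rewrite zf fB; have := subsetP sAB g; rewrite !inE eq_sym ne gA => /(_ isT).
by have := subsetP sAB z; rewrite !inE nez zA => /(_ isT).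
Qed.

(** Since [g] records whether [f] was present, removing [f] neither empties a circuit nor creates
    new inclusions. The minimality condition in [contract] is thus automatic. *)
Lemma contract_seriesP M f g D : is_matroid M -> in_series M f g ->
  reflect (exists2 C, C \in circ M & D = C :\ f) (D \in circ (contract M [set f])).
Proof.
move=> mM /in_seriesP[ne ser]; rewrite inE.
apply: (iffP minsetP) => [[/andP[_ /exists_inP[C cC /eqP->]] _]|[C cC ->]].
  by exists C.
split.
  apply/andP; split; last by apply/exists_inP; exists C.
  have [x xC] := circ_nonempty mM cC; apply/set0Pn.
  have [xf|nex] := eqVneq x f; last by exists x; rewrite !inE nex.
  by exists g; rewrite !inE eq_sym ne -ser // -xf.
move=> D' /andP[_ /exists_inP[C' cC' /eqP->]] sC'.
congr (_ :\ f); apply: (circ_antichain mM cC' cC).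
by apply: (setD1_sub_series ne) sC'; apply: ser.
Qed.

Lemma in_series_inj M f g A B : is_matroid M -> in_series M f g ->
  A \in circ M -> B \in circ M -> A :\ f = B :\ f -> A = B.
Proof.
move=> mM /in_seriesP[ne ser] cA cB eAB; apply: (circ_antichain mM cA cB).
by apply: (setD1_sub_series ne); rewrite ?ser ?eAB.
Qed.

Lemma contract_series_matroid M f g : is_matroid M -> in_series M f g ->
  is_matroid (contract M [set f]).
Proof.
move=> mM ser; have [ne serC] := in_seriesP _ _ _ ser.
have circP := contract_seriesP _ mM ser; split.
- by move=> D /circP[C cC ->]; rewrite /= setSD ?circ_sub.
- by rewrite inE; apply/negP => /minsetP[]; rewrite eqxx.
- move=> D1 D2 /circP[C1 c1 ->] /circP[C2 c2 ->] s12.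
  congr (_ :\ f); apply: (circ_antichain mM c1 c2).
  by apply: (setD1_sub_series ne) s12; apply: serC.
move=> D1 D2 e /circP[C1 c1 ->] /circP[C2 c2 ->] ne12; rewrite !inE.
case/andP=> /andP[nef e1] /andP[_ e2].
have neC : C1 != C2 by apply: contraNneq ne12 => ->.
have [C3 c3 s3] := weak_elim mM c1 c2 neC e1 e2.
exists (C3 :\ f); first by apply/circP; exists C3.
by set_sub.
Qed.

(** Removing [f] is a bijection between the circuits that preserves and reflects inclusion and
    disjointness, with [g] standing in for [f]. *)
Lemma contract_series_skew_pair M f g C1 C2 : is_matroid M ->
  in_series M f g -> C1 \in circ M -> C2 \in circ M ->
  skew_pair (contract M [set f]) (C1 :\ f) (C2 :\ f) <-> skew_pair M C1 C2.
Proof.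
move=> mM ser c1 c2; have [ne serC] := in_seriesP _ _ _ ser.
have circP := contract_seriesP _ mM ser.
split=> [[_ _ dis only]|[_ _ dis only]]; split=> //.
- apply/pred0P => z; apply/negbTE/negP => /= /andP[z1 z2].
  have [w [w1 w2 nef]] : exists w, [/\ w \in C1, w \in C2 & w != f].
    have [zf|nez] := eqVneq z f; last by exists z.
    by exists g; rewrite eq_sym ne -(serC C1) // -(serC C2) // -zf.
  by move: (disjointFr dis (x := w)); rewrite !inE nef w1 w2 => /(_ isT).
- move=> C cC sC; have cCf : C :\ f \in circ (contract M [set f]).
    by apply/circP; exists C.
  have sCf : C :\ f \subset C1 :\ f :|: C2 :\ f by rewrite -setDUl setSD.
  by case: (only _ cCf sCf) => /(in_series_inj mM ser cC) eqC;
    [left|right]; apply: eqC.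
- by apply/circP; exists C1.
- by apply/circP; exists C2.
- by apply: disjointW dis; apply: subsetDl.
move=> D /circP[C cC ->] sC.
suff sC12 : C \subset C1 :|: C2 by case: (only C cC sC12) => ->; [left|right].
apply: (setD1_sub_series ne); rewrite ?inE ?serC //.
by rewrite setDUl.
Qed.

Lemma series_minor_skew_pair M N : series_minor N M -> is_matroid M ->
  is_matroid N /\
  ((exists C1 C2, skew_pair N C1 C2) -> exists C1 C2, skew_pair M C1 C2).
Proof.
elim=> {M N} [//|N M e _ _ IH|N M f g ne cofg _ IH] mM.
  have [mN skN] := IH (delete_matroid e mM); split=> // /skN[C1 [C2]].
  by move/delete_skew_pair; exists C1, C2.
have ser := cocircuit_in_series mM ne cofg.
have [mN skN] := IH (contract_series_matroid mM ser); split=> // /skN[D1 [D2 sk]].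
case: (sk) => /(contract_seriesP _ mM ser)[C1 c1 e1].
case/(contract_seriesP _ mM ser)=> [C2 c2 e2] _ _.
by exists C1, C2; apply/(contract_series_skew_pair mM ser); rewrite -?e1 -?e2.
Qed.

(* The circuit structure of a subdivision of the series connection: two skew
   circuits and a set [P] contained in every further circuit. *)
Record theta M C1 C2 P : Prop := Theta {
  theta_skew : skew_pair M C1 C2;
  theta_ground : ground M = C1 :|: C2 :|: P;
  theta_ne0 : exists p, p \in P;
  theta_disj : forall x, x \in P -> (x \notin C1) && (x \notin C2);
  theta_circ : forall C, C \in circ M -> C != C1 -> C != C2 -> P \subset C
}.

Lemma skew_pair_sym M C1 C2 : skew_pair M C1 C2 -> skew_pair M C2 C1.
Proof.
case=> c1 c2 dis only; split=> //; first by rewrite disjoint_sym.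
by move=> C cC; rewrite setUC => sC; case: (only C cC sC); [right|left].
Qed.

Lemma theta_sym M C1 C2 P : theta M C1 C2 P -> theta M C2 C1 P.
Proof.
case=> sk gr ne0 dis only; split=> //; first exact: skew_pair_sym.
- by rewrite gr [C1 :|: C2]setUC.
- by move=> x /dis; rewrite andbC.
by move=> C cC ne1 ne2; apply: only.
Qed.

(* Eliminating an element of [P] between [D] and [D'] while keeping [x] leaves a
   circuit that avoids part of [P], hence is [C1]. *)
Lemma theta_cover M C1 C2 P D D' x : is_matroid M -> theta M C1 C2 P ->
  D \in circ M -> D' \in circ M -> P \subset D -> P \subset D' ->
  x \in C1 -> x \in D -> x \notin D' -> C1 \subset D :|: D'.
Proof.
move=> mM th dD dD' sD sD' x1 xD xD'.
have [c1 c2 dis _] := theta_skew th; have [p pP] := theta_ne0 th.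
have pD := subsetP sD p pP; have pD' := subsetP sD' p pP.
have [C [cC xC sC]] := strong_elim mM dD dD' pD pD' xD xD'.
have pC : p \notin C by apply/negP => /(subsetP sC); rewrite !inE eqxx.
have ne2 : C != C2 by apply: contraTneq xC => ->; rewrite (disjointFr dis).
have <- : C = C1; last by set_sub.
apply/eqP; apply: contraT => ne1.
by rewrite (subsetP (theta_circ th cC ne1 ne2)) in pC.
Qed.

Lemma theta_neq M C1 C2 P D : theta M C1 C2 P -> P \subset D ->
  D != C1 /\ D != C2.
Proof.
move=> th sD; have [p pP] := theta_ne0 th; have pD := subsetP sD p pP.
have /andP[p1 p2] := theta_disj th pP.
by split; [apply: contraNneq p1 => <-|apply: contraNneq p2 => <-].
Qed.

(** The traces on the two circuits vary independently. Eliminate [a] between [D] and [C1], keeping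
    an element of [P]. The result gains nothing in [C2]; had it lost an element there, [theta_cover]
    would put all of [C2] inside [D]. *)
Lemma theta_exchange M C1 C2 P D a : is_matroid M -> theta M C1 C2 P ->
  D \in circ M -> P \subset D -> a \in C1 ->
  exists D', [/\ D' \in circ M, P \subset D', a \notin D' &
    forall y, y \in C2 -> (y \in D') = (y \in D)].
Proof.
move=> mM th dD sD a1; have [aD|aD] := boolP (a \in D); last by exists D.
have [c1 c2 dis _] := theta_skew th; have [p pP] := theta_ne0 th.
have /andP[p1 p2] := theta_disj th pP; have pD := subsetP sD p pP.
have [D' [dD' pD' sD'D]] := strong_elim mM dD c1 aD a1 pD p1.
have sD' : P \subset D'.
  by apply: (theta_circ th) => //; [apply: contraNneq p1 => <-|
    apply: contraNneq p2 => <-].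
exists D'; split=> //; first by apply/negP => /(subsetP sD'D); rewrite !inE eqxx.
have sub y : y \in C2 -> y \in D' -> y \in D.
  move=> y2 /(subsetP sD'D); rewrite !inE => /andP[_ /orP[//|]].
  by rewrite (disjointFl dis y2).
move=> y y2; apply/idP/idP => [|yD]; first exact: sub.
apply: contraT => yD'.
have cov := theta_cover mM (theta_sym th) dD dD' sD sD' y2 yD yD'.
have [_ neD2] := theta_neq th sD; case/eqP: neD2; apply/esym.
apply: (circ_antichain mM c2 dD); apply/subsetP => z z2.
by move: (subsetP cov z z2); rewrite inE => /orP[//|]; apply: sub.
Qed.

(** A further circuit containing one of [x], [y] covers [C1] together with [D], so it contains the
    other. *)
Lemma theta_series M C1 C2 P D x y : is_matroid M -> theta M C1 C2 P ->
  D \in circ M -> P \subset D -> x \in C1 -> y \in C1 -> x \notin D ->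
  y \notin D -> x != y -> in_series M x y.
Proof.
move=> mM th dD sD x1 y1 xD yD ne; apply/in_seriesP; split=> // C cC.
have [_ _ dis _] := theta_skew th.
have [->|ne1] := eqVneq C C1; first by rewrite x1 y1.
have [->|ne2] := eqVneq C C2; first by rewrite !(disjointFr dis).
have sC := theta_circ th cC ne1 ne2.
have half u v : u \in C1 -> v \in C1 -> u \notin D -> v \notin D ->
    u \in C -> v \in C.
  move=> u1 v1 uD vD uC; have cov := theta_cover mM th cC dD sC sD u1 uC uD.
  by move: (subsetP cov v v1); rewrite inE (negPf vD) orbF.
by apply/idP/idP; apply: half.
Qed.

Lemma theta_miss M C1 C2 P D : is_matroid M -> theta M C1 C2 P ->
  (forall f g, f \in ground M -> ~~ in_series M f g) -> D \in circ M -> P \subset D ->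
  exists2 a, a \in C1 & D :&: C1 = C1 :\ a.
Proof.
move=> mM th noser dD sD; have [c1 _ _ _] := theta_skew th.
have [ne1 _] := theta_neq th sD.
have [a a1 aD] : exists2 a, a \in C1 & a \notin D.
  by apply: circ_diff mM c1 dD _; rewrite eq_sym.
exists a => //; apply/setP => z; rewrite !inE andbC.
have [->|ne] := eqVneq z a; first by rewrite a1 (negPf aD).
have [z1|] := boolP (z \in C1) => //=; apply: contraT => zD.
case/negP: (noser z a (subsetP (circ_sub mM c1) z z1)).
exact: theta_series mM th dD sD z1 a1 zD aD ne.
Qed.

Lemma theta_single M C1 C2 P : is_matroid M -> theta M C1 C2 P ->
  (forall f g, f \in ground M -> ~~ in_series M f g) -> exists p, P = [set p].
Proof.
move=> mM th noser; have [p pP] := theta_ne0 th; exists p.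
apply/setP => q; rewrite inE; apply/idP/eqP => [qP|->//].
apply/eqP; apply: contraT => ne.
have qE : q \in ground M by rewrite (theta_ground th) inE qP orbT.
apply: contraNT (noser q p qE) => _; apply/in_seriesP; split=> // C cC.
have /andP[p1 p2] := theta_disj th pP; have /andP[q1 q2] := theta_disj th qP.
have [->|ne1] := eqVneq C C1; first by rewrite (negPf p1) (negPf q1).
have [->|ne2] := eqVneq C C2; first by rewrite (negPf p2) (negPf q2).
by have sC := theta_circ th cC ne1 ne2; rewrite !(subsetP sC).
Qed.

(* Without series pairs, the circuits are those of the series connection of
   two uniform matroids of corank 2 at [p]. *)
Lemma theta_cosimple M C1 C2 P D : is_matroid M -> theta M C1 C2 P ->
  (forall f g, f \in ground M -> ~~ in_series M f g) -> D \in circ M -> P \subset D ->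
  exists p, [/\ p \notin C1, p \notin C2, ground M = p |: (C1 :|: C2) &
    forall C, C \in circ M <-> [\/ C = C1, C = C2 |
        exists a b, [/\ a \in C1, b \in C2 & C = ground M :\ a :\ b]]].
Proof.
move=> mM th noser dD sD; have [p eP] := theta_single mM th noser.
have pP : p \in P by rewrite eP inE.
have /andP[p1 p2] := theta_disj th pP; exists p.
have [c1 c2 dis _] := theta_skew th.
have gr : ground M = p |: (C1 :|: C2) by rewrite (theta_ground th) eP setUC.
(* A circuit through [P] misses exactly one element of each of [C1] and [C2], and these two
   determine it. *)
have shape C a b : C \in circ M -> P \subset C -> a \in C1 -> b \in C2 ->
    a \notin C -> b \notin C -> C = ground M :\ a :\ b.
  move=> cC sC a1 b2 aC bC.
  have [a' _ ea] := theta_miss mM th noser cC sC.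
  have [b' _ eb] := theta_miss mM (theta_sym th) noser cC sC.
  have aa : a = a'.
    by move/setP/(_ a): ea; rewrite !inE a1 (negPf aC) !andbT => /esym/negbFE/eqP.
  have bb : b = b'.
    by move/setP/(_ b): eb; rewrite !inE b2 (negPf bC) !andbT => /esym/negbFE/eqP.
  subst a' b'; apply/setP => z; move/setP/(_ z): ea; move/setP/(_ z): eb.
  rewrite gr !inE.
  have [->|nez] := eqVneq z p.
    rewrite (subsetP sC) //= andbT => _ _; apply/esym/andP; split.
      by apply: contraNneq p2 => ->.
    by apply: contraNneq p1 => ->.
  have [z1|z1] := boolP (z \in C1).
    have z2 : z \notin C2 by rewrite (disjointFr dis).
    have -> : z != b by apply: contraNneq z2 => ->.
    by rewrite !andbT.
  have -> : z != a by apply: contraNneq z1 => ->.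
  have [z2|z2] := boolP (z \in C2); first by rewrite !andbT => ->.
  rewrite /= !andbF => _ _; apply/negbTE; apply: contra z1 => zC.
  by move: (subsetP (circ_sub mM cC) z zC); rewrite gr !inE (negPf nez) (negPf z2) orbF.
split=> // C; split=> [cC|[->//|->//|[a [b [a1 b2 ->]]]]].
  have [->|ne1] := eqVneq C C1; first by constructor 1.
  have [->|ne2] := eqVneq C C2; first by constructor 2.
  constructor 3; have sC := theta_circ th cC ne1 ne2.
  have [a a1 ea] := theta_miss mM th noser cC sC.
  have [b b2 eb] := theta_miss mM (theta_sym th) noser cC sC.
  exists a, b; split=> //; apply: shape => //.
    by move/setP/(_ a): ea; rewrite !inE eqxx a1 andbT /= => ->.
  by move/setP/(_ b): eb; rewrite !inE eqxx b2 andbT /= => ->.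
(* For arbitrary [a] and [b], exchange first in [C1] and then in [C2]; the second exchange preserves
   the trace on [C1], so [a] stays missing. *)
have [D1 [d1 s1 aD1 _]] := theta_exchange mM th dD sD a1.
have [D2 [d2 s2 bD2 eD2]] := theta_exchange mM (theta_sym th) d1 s1 b2.
by rewrite -(shape D2 a b) // eD2.
Qed.

Lemma theta_of_minimal M C1 C2 D : is_matroid M -> skew_pair M C1 C2 ->
  D \in circ M -> D :&: C1 != set0 -> D :&: C2 != set0 ->
  (forall C, C \in circ M -> C :&: C1 != set0 -> C :&: C2 != set0 ->
     #|D :\: (C1 :|: C2)| <= #|C :\: (C1 :|: C2)|) ->
  ground M = C1 :|: C2 :|: D ->
  theta M C1 C2 (D :\: (C1 :|: C2)).
Proof.
move=> mM sk dD meet1 meet2 minD gr; set P := D :\: _.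
have inP x : x \in P = [&& x \notin C1, x \notin C2 & x \in D].
  by rewrite !inE negb_or andbA.
have [c1 c2 dis only] := sk.
have notsub : ~~ (D \subset C1 :|: C2).
  apply/negP => /(only D dD)[] eD; subst D.
    by rewrite setI_eq0 dis in meet2.
  by rewrite setI_eq0 disjoint_sym dis in meet1.
(* The part of [C] outside [C1 :|: C2] lies in [P] and is no smaller than [P], so it equals [P]. *)
have full C : C \in circ M -> C :&: C1 != set0 -> C :&: C2 != set0 -> P \subset C.
  move=> cC m1 m2; have sCP : C :\: (C1 :|: C2) \subset P.
    have := circ_sub mM cC; rewrite gr => sC; rewrite /P; set_sub.
  have : C :\: (C1 :|: C2) = P.
    by apply/eqP; rewrite eqEcard sCP minD.
  by move=> <-; apply: subsetDl.
(* Every circuit meeting [P] meets both circuits; [E1], [E2] stand for [C1], [C2] in either order.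
   If [C] avoids [E2], eliminate [p] between [D] and [C], keeping [d] in [E2]. The result misses
   [p], so by [fullE] it avoids [E1], and then it lies strictly inside [D]. *)
have miss C E1 E2 : C \in circ M -> C :&: P != set0 -> C :&: E2 = set0 ->
    D :&: E2 != set0 ->
    C1 :|: C2 = E1 :|: E2 -> 
    (forall C, C \in circ M -> C :&: E1 != set0 -> C :&: E2 != set0 -> P \subset C) ->
    False.
  move=> cC /set0Pn[p]; rewrite inE => /andP[pC pP] C0 /set0Pn[d].
  rewrite inE => /andP[dD' dE2] eqU fullE.
  have pD : p \in D by move: pP; rewrite inP => /and3P[].
  have dC : d \notin C by apply/negP => dC; move/setP/(_ d): C0; rewrite !inE dC dE2.
  have [D' [cD' dD3 sD']] := strong_elim mM dD cC pD pC dD' dC.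
  have pD' : p \notin D' by apply/negP => /(subsetP sD'); rewrite !inE eqxx.
  have [m1|/negbNE/eqP m1] := boolP (D' :&: E1 != set0).
    suff /subsetP/(_ p pP) : P \subset D' by rewrite (negPf pD').
    by apply: fullE => //; apply/set0Pn; exists d; rewrite inE dD3.
  case: (circ_sub_indep mM dD cD' pD); apply/subsetP => z zD'.
  rewrite in_setD1; apply/andP; split; first by apply: contraNneq pD' => <-.
  move: (subsetP sD' z zD'); rewrite !inE => /andP[_ /orP[//|zC]].
  have := subsetP (circ_sub mM cC) z zC; rewrite gr eqU !inE -orbA.
  case/or3P=> // zE.
    by move/setP/(_ z): m1; rewrite !inE zD' zE.
  by move/setP/(_ z): C0; rewrite !inE zC zE.
have dis0 : C1 :&: C2 = set0 by apply/eqP; rewrite setI_eq0.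
split=> //.
- by rewrite gr /P; apply/setP => z; rewrite !inE negb_or; case: (z \in C1);
  case: (z \in C2).
- case/subsetPn: notsub => p pD pN; exists p.
  by rewrite inE pN.
- by move=> x; rewrite inP => /and3P[-> ->].
move=> C cC ne1 ne2.
have mP : C :&: P != set0.
  have /subsetPn[p pC pN] : ~~ (C \subset C1 :|: C2).
    by apply/negP => /(only C cC)[] eC; rewrite eC eqxx in ne1 ne2.
  apply/set0Pn; exists p; rewrite inE pC inE pN.
  by have := subsetP (circ_sub mM cC) p pC; rewrite gr inE (negPf pN).
have [m1|/negbNE/eqP m1] := boolP (C :&: C1 != set0); last first.
  case: (miss C C2 C1) => //; first by rewrite setUC.
  by move=> C' cC' *; apply: full.
have [m2|/negbNE/eqP m2] := boolP (C :&: C2 != set0); last first.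
  by case: (miss C C1 C2).
exact: full.
Qed.

End SeriesMinors.

(** * Series connections of uniform matroids *)

(** With [m] and [n] the sizes of a set and of its complement, this identifies circuits of corank-2
    uniform matroids as complements of singletons. The hypothesis prevents truncation of the
    subtraction. *)
Lemma eq_corank2 m n : 2 <= m + n -> (m == (m + n - 2).+1) = (n == 1).
Proof.
case: n => [|n]; rewrite ?addn0 ?addnS => lt; rewrite -subSn // subSS subn1 /=.
  by case: m lt => // m _; rewrite eq_sym ltn_eqF.
by rewrite -{1}[m]addn0 eqn_add2l eq_sym.
Qed.

Lemma circ_uniform_corank2 k (X : {set 'I_k}) : 2 <= k ->
  X \in circ (uniform (k - 2) k) <-> exists x, X = [set~ x].
Proof.
move=> k2; rewrite inE; have cC := cardsC X; rewrite card_ord in cC.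
have -> : (#|X| == (k - 2).+1) = (#|~: X| == 1).
  by have := @eq_corank2 #|X| #|~: X|; rewrite cC; apply.
by split=> [/cards1P[x eX]|[x ->]]; [exists x; rewrite -eX setCK|rewrite setCK cards1].
Qed.

(** A named copy of the local function [g] of [series_conn]. *)
Definition glue (T1 T2 : finType) (p1 : T1) (p2 : T2) (x : T2) : T1 + T2 :=
  if x == p2 then inl p1 else inr x.

Lemma circ_series_uniform k l (p1 : 'I_k) (p2 : 'I_l) X : 2 <= k -> 2 <= l ->
  X \in circ (series_conn (uniform (k - 2) k) (uniform (l - 2) l) p1 p2) <->
  [\/ X = inl @: [set~ p1], X = glue p1 p2 @: [set~ p2] |
    exists x y, [/\ x != p1, y != p2 &
      X = inl @: [set~ x] :|: glue p1 p2 @: [set~ y]]].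
Proof.
move=> k2 l2; rewrite [circ _]/= !in_setU -orbA; split.
  case/or3P=> [/imsetP[C]|/imsetP[C]|/imset2P[A B]].
  - rewrite inE => /andP[/circ_uniform_corank2-/(_ k2)[x ->]].
    by rewrite !inE negbK => /eqP<- ->; constructor 1.
  - rewrite inE => /andP[/circ_uniform_corank2-/(_ l2)[x ->]].
    by rewrite !inE negbK => /eqP<- ->; constructor 2.
  move=> /circ_uniform_corank2-/(_ k2)[x ->].
  rewrite inE => /andP[/circ_uniform_corank2-/(_ l2)[y ->]].
  by rewrite !inE => /andP[nx ny] ->; constructor 3; exists x, y; split;
    rewrite // eq_sym.
have cx x : [set~ x] \in circ (uniform (k - 2) k).
  by apply/circ_uniform_corank2 => //; exists x.
have cy y : [set~ y] \in circ (uniform (l - 2) l).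
  by apply/circ_uniform_corank2 => //; exists y.
case=> [->|->|[x [y [nx ny ->]]]]; apply/or3P.
- by constructor 1; apply/imsetP; exists [set~ p1]; rewrite // inE; apply/andP;
  split; [exact: cx|rewrite setC11].
- by constructor 2; apply/imsetP; exists [set~ p2]; rewrite // inE; apply/andP;
  split; [exact: cy|rewrite setC11].
constructor 3; apply/imset2P; exists [set~ x] [set~ y]; [exact: cx| |by []].
by rewrite inE; apply/and3P; split; [exact: cy|rewrite !inE eq_sym..].
Qed.

Lemma glue_inl (T1 T2 : finType) (p1 x : T1) (p2 y : T2) :
  glue p1 p2 y = inl x -> y = p2 /\ x = p1.
Proof. by rewrite /glue; case: eqP => // -> [->]. Qed.

(** These are the two circuits avoiding the basepoint; every other circuit contains [inl p1] and so
    leaves their union. *)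
Lemma series_uniform_skew k l (p1 : 'I_k) (p2 : 'I_l) : 2 <= k -> 2 <= l ->
  skew_pair (series_conn (uniform (k - 2) k) (uniform (l - 2) l) p1 p2)
    (inl @: [set~ p1]) (glue p1 p2 @: [set~ p2]).
Proof.
move=> k2 l2; have circP := circ_series_uniform p1 p2 _ k2 l2.
split; [by apply/circP; constructor 1|by apply/circP; constructor 2| |].
  apply/pred0P => z; apply/negbTE/negP => /= /andP[/imsetP[x _ ->]].
  case/imsetP=> y; rewrite !inE => ny /esym/glue_inl[ey _].
  by rewrite ey eqxx in ny.
move=> C /circP[->|->|[x [y [nx ny ->]]]]; [by left|by right|].
move/subsetP/(_ (inl p1)); rewrite !inE imset_f /=; last by rewrite !inE eq_sym.
case/(_ isT)/orP=> /imsetP[z]; rewrite !inE => nz.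
  by case=> ez; rewrite ez eqxx in nz.
by move/esym/glue_inl=> [ez _]; rewrite ez eqxx in nz.
Qed.

(** The map is injective only on the ground set, so circuits are pulled back by preimages cut down
    to [ground M]. *)
Lemma isomorphic_skew_pair (T T' : finType) (M : mat T) (N : mat T')
    (D1 D2 : {set T'}) :
  (forall C, C \in circ M -> C \subset ground M) ->
  isomorphic M N -> D1 \subset ground N -> D2 \subset ground N ->
  skew_pair N D1 D2 -> exists C1 C2, skew_pair M C1 C2.
Proof.
move=> sM [f [injf imf circf]] s1 s2 [d1 d2 dis only].
pose pre (D : {set T'}) := [set x in ground M | f x \in D].
have sub_pre D : pre D \subset ground M by apply/subsetP => x; rewrite inE => /andP[].
have preK (D : {set T'}) : D \subset ground N -> f @: pre D = D.
  move=> sD; apply/setP => y; apply/imsetP/idP => [[x + ->]|yD].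
    by rewrite inE => /andP[].
  have: y \in f @: ground M by rewrite imf (subsetP sD).
  by case/imsetP=> x xE ey; exists x; rewrite // inE xE -ey.
have imK (C : {set T}) : C \subset ground M -> pre (f @: C) = C.
  move=> sC; apply/setP => x; rewrite inE; apply/andP/idP => [[xE]|xC].
    by case/imsetP=> y yC /injf ->//; apply: (subsetP sC).
  by rewrite (subsetP sC) // imset_f.
exists (pre D1), (pre D2); split; rewrite ?circf ?preK //.
  apply/pred0P => x; apply/negbTE/negP => /=; rewrite !inE.
  by case/andP=> /andP[_ x1] /andP[_]; rewrite (disjointFr dis).
move=> C cC sC; have sCE := sM C cC.
have cfC : f @: C \in circ N by rewrite -circf.
have sfC : f @: C \subset D1 :|: D2.
  by apply: subset_trans (imsetS f sC) _; rewrite imsetU !preK.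
by rewrite -(imK C sCE); case: (only _ cfC sfC) => ->; [left|right].
Qed.

Section SeriesConnection.
Context {T : finType}.
Implicit Types (M N : mat T) (C D : {set T}) (x : T).

(** The position of [x] in an enumeration of [C], unrelated to matroid rank. It is shifted by one so
    that [ord0] remains free for the basepoint. *)
Definition rank_in C x : 'I_(#|C|.+1) := inord (index x (enum C)).+1.

Lemma rank_in_val C x : x \in C -> rank_in C x = (index x (enum C)).+1 :> nat.
Proof. by move=> xC; rewrite inordK // ltnS cardE index_mem mem_enum. Qed.

Lemma rank_in_inj C : {in C &, injective (rank_in C)}.
Proof.
move=> x y xC yC /(congr1 val); rewrite /= !rank_in_val // => -[].
by apply: index_inj; rewrite ?mem_enum.
Qed.

Lemma rank_in_neq0 C x : x \in C -> rank_in C x != ord0.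
Proof. by move=> xC; rewrite -val_eqE /= rank_in_val. Qed.

Lemma imset_rank_in C : rank_in C @: C = [set~ ord0].
Proof.
apply/eqP; rewrite eqEcard; apply/andP; split.
  by apply/subsetP => _ /imsetP[x xC ->]; rewrite !inE rank_in_neq0.
by rewrite card_in_imset; [rewrite cardsC1 card_ord|apply: rank_in_inj].
Qed.

Lemma imset_rank_inD1 C x : x \in C ->
  ord0 |: rank_in C @: (C :\ x) = [set~ rank_in C x].
Proof.
move=> xC; apply/setP => i; rewrite !inE.
have [->|ne0] := eqVneq i ord0; first by rewrite eq_sym rank_in_neq0.
have: i \in rank_in C @: C by rewrite imset_rank_in !inE.
case/imsetP=> y yC -> /=; apply/imsetP/idP => [[z]|ne].
  rewrite !inE => /andP[nez zC] /rank_in_inj -> //; apply: contraNneq nez.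
  by move/rank_in_inj ->.
by exists y => //; rewrite !inE yC andbT; apply: contraNneq ne => ->.
Qed.

(** Number [C1] on the left and [C2] on the right, and send [p] to the basepoint. Omitting [a] and
    [b] then corresponds to choosing one circuit through the basepoint on each side. *)
Lemma theta_isomorphic M C1 C2 p :
  [disjoint C1 & C2] -> p \notin C1 -> p \notin C2 ->
  1 < #|C1| -> 1 < #|C2| ->
  ground M = p |: (C1 :|: C2) ->
  (forall C, C \in circ M <-> [\/ C = C1, C = C2 |
     exists a b, [/\ a \in C1, b \in C2 & C = ground M :\ a :\ b]]) ->
  isomorphic M (series_conn (uniform (#|C1|.+1 - 2) #|C1|.+1)
    (uniform (#|C2|.+1 - 2) #|C2|.+1) ord0 ord0).
Proof.
move=> dis p1 p2 k2 l2 gr circP.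
pose g := @glue 'I_#|C1|.+1 'I_#|C2|.+1 ord0 ord0.
pose f x : 'I_#|C1|.+1 + 'I_#|C2|.+1 := if x \in C1 then inl (rank_in C1 x)
  else if x \in C2 then inr (rank_in C2 x) else inl ord0.
have f1 x : x \in C1 -> f x = inl (rank_in C1 x) by rewrite /f => ->.
have f2 x : x \in C2 -> f x = g (rank_in C2 x).
  move=> x2; rewrite /f (disjointFl dis) // x2 /g /glue.
  by rewrite (negPf (rank_in_neq0 x2)).
have f2' x : x \in C2 -> f x = inr (rank_in C2 x).
  by move=> x2; rewrite /f (disjointFl dis) // x2.
have fp : f p = inl ord0 by rewrite /f (negPf p1) (negPf p2).
have g0 : g ord0 = inl ord0 by rewrite /g /glue eqxx.
have im1 (A : {set T}) : A \subset C1 -> f @: A = inl @: (rank_in C1 @: A).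
  by move=> sA; rewrite -imset_comp; apply: eq_in_imset => x /(subsetP sA)/f1.
have im2 (A : {set T}) : A \subset C2 -> f @: A = g @: (rank_in C2 @: A).
  by move=> sA; rewrite -imset_comp; apply: eq_in_imset => x /(subsetP sA)/f2.
have im12 a b : a \in C1 -> b \in C2 -> f @: (ground M :\ a :\ b) =
    inl @: [set~ rank_in C1 a] :|: g @: [set~ rank_in C2 b].
  move=> a1 b2; have a2 : a \notin C2 by rewrite (disjointFr dis).
  have b1 : b \notin C1 by rewrite (disjointFl dis).
  (* The basepoint is duplicated so that each half maps onto the complement of a singleton. *)
  have -> : ground M :\ a :\ b = p |: (C1 :\ a) :|: (p |: (C2 :\ b)).
    rewrite gr; apply/setP => z; rewrite !inE.
    have [->|_] := eqVneq z p => /=.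
      by rewrite andbT; apply/andP; split; [apply: contraNneq p2 => ->|
        apply: contraNneq p1 => ->].
    have [->|_] := eqVneq z b => /=; first by rewrite (negPf b1) andbF.
    have [->|_] := eqVneq z a => //=; first by rewrite (negPf a2).
  rewrite -!imset_rank_inD1 // imsetU !imsetU1 fp g0.
  by rewrite im1 ?subsetDl // im2 ?subsetDl.
have injf : {in ground M &, injective f}.
  move=> x y; rewrite gr !inE.
  case/or3P=> [/eqP->|x1|x2]; [rewrite fp|rewrite (f1 x) //|rewrite (f2' x) //];
    (case/or3P=> [/eqP->|y1|y2]; [rewrite ?fp //|rewrite (f1 y) //|rewrite (f2' y) //]).
  - by case=> e0; move: (rank_in_neq0 y1); rewrite -e0.
  - by case=> e0; move: (rank_in_neq0 x1); rewrite e0.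
  - by case=> /rank_in_inj; apply.
  by case=> /rank_in_inj; apply.
have sC C : C \in circ M -> C \subset ground M.
  case/circP=> [->|->|[a [b [_ _ ->]]]]; rewrite gr.
  - by rewrite subsetU // subsetUl orbT.
  - by rewrite subsetU // subsetUr orbT.
  by apply: subset_trans (subsetDl _ _) (subsetDl _ _).
have imC1 : f @: C1 = inl @: [set~ ord0] by rewrite im1 // imset_rank_in.
have imC2 : f @: C2 = g @: [set~ ord0] by rewrite im2 // imset_rank_in.
have im_inj (X Y : {set T}) : X \subset ground M -> Y \subset ground M ->
    f @: X = f @: Y -> X \subset Y.
  move=> sX sY eXY; apply/subsetP => x xX.
  have: f x \in f @: Y by rewrite -eXY imset_f.
  by case/imsetP=> y yY /injf ->//; [apply: (subsetP sX)|apply: (subsetP sY)].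
have circS := circ_series_uniform (@ord0 #|C1|) (@ord0 #|C2|) _ (leqW k2) (leqW l2).
exists f; split=> //.
  rewrite gr imsetU1 imsetU imC1 imC2 fp /= -/g.
  apply/setP => z; rewrite !inE; apply/idP/idP.
    case/or3P=> [/eqP->|/imsetP[i _ ->]|/imsetP[i _ ->]].
    - by rewrite imset_f ?inE.
    - by rewrite imset_f ?inE.
    by rewrite orbC imset_f ?inE.
  case/orP=> /imsetP[i _ ->].
    by have [->|ne] := eqVneq i ord0; rewrite ?eqxx // imset_f ?orbT // !inE.
  have [_|ne] := eqVneq i ord0; first by rewrite eqxx.
  have -> : inr i = g i by rewrite /g /glue (negPf ne).
  by rewrite (imset_f g) ?orbT // !inE.
move=> X sX; apply/idP/idP.
  move=> cX; apply/circS; case/circP: cX => [->|->|[a [b [a1 b2 ->]]]].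
  - by constructor 1.
  - by constructor 2.
  constructor 3; exists (rank_in C1 a), (rank_in C2 b).
  by rewrite !rank_in_neq0 // im12.
(* Each circuit of the series connection is the image of a circuit of [M]; injectivity on the ground
   set then identifies [X] with it. *)
move=> cX; have [C cC eC] : exists2 C, C \in circ M & f @: X = f @: C.
  case/circS: cX => [eX|eX|[i [j [ni nj eX]]]].
  - by exists C1; [apply/circP; constructor 1|rewrite imC1].
  - by exists C2; [apply/circP; constructor 2|rewrite imC2].
  have : i \in rank_in C1 @: C1 by rewrite imset_rank_in !inE.
  have : j \in rank_in C2 @: C2 by rewrite imset_rank_in !inE.
  case/imsetP=> b b2 ej /imsetP[a a1 ei].
  exists (ground M :\ a :\ b); last by rewrite im12 // -ei -ej.
  by apply/circP; constructor 3; exists a, b.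
suff -> : X = C by [].
by apply/eqP; rewrite eqEsubset; apply/andP; split; apply: im_inj => //; apply: sC.
Qed.

(** Induction on the size of the ground set: delete elements outside [C1 :|: C2 :|: D], contract one
    element of a series pair, and stop at a [theta] without series pairs. A single circuit meeting
    both [C1] and [C2] replaces connectedness, and it survives each reduction. *)
Lemma series_minor_of_skew_pair M C1 C2 D : is_matroid M ->
  skew_pair M C1 C2 -> D \in circ M -> D :&: C1 != set0 -> D :&: C2 != set0 ->
  exists (k l : nat) (p1 : 'I_k) (p2 : 'I_l) (N : mat T),
    [/\ 3 <= k, 3 <= l, series_minor N M &
      isomorphic N (series_conn (uniform (k - 2) k) (uniform (l - 2) l) p1 p2)].
Proof.
elim: {M}_.+1 {-2}M (ltnSn #|ground M|) C1 C2 D => // n IH M.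
rewrite ltnS => leMn C1 C2 D0 mM sk d0 meet1 meet2.
have reduce M' : is_matroid M' -> #|ground M'| < #|ground M| ->
    (forall N, series_minor N M' -> series_minor N M) ->
    (exists E1 E2 E, [/\ skew_pair M' E1 E2, E \in circ M', E :&: E1 != set0 &
       E :&: E2 != set0]) ->
    exists (k l : nat) (p1 : 'I_k) (p2 : 'I_l) (N : mat T),
      [/\ 3 <= k, 3 <= l, series_minor N M &
        isomorphic N (series_conn (uniform (k - 2) k) (uniform (l - 2) l) p1 p2)].
  move=> mM' lt lift [E1 [E2 [E [sk' cE m1 m2]]]].
  have [k [l [q1 [q2 [N [k3 l3 /lift sN iso]]]]]] :=
    IH M' (leq_trans lt leMn) E1 E2 E mM' sk' cE m1 m2.
  by exists k, l, q1, q2, N.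
pose P (D : {set T}) := [&& D \in circ M, D :&: C1 != set0 & D :&: C2 != set0].
have P0 : P D0 by rewrite /P d0 meet1.
case: (arg_minnP (fun D : {set T} => #|D :\: (C1 :|: C2)|) P0).
move=> D /and3P[dD m1 m2] minD {D0 d0 P0 meet1 meet2}.
have [c1 c2 dis _] := sk.
have sZ : C1 :|: C2 :|: D \subset ground M by rewrite !subUset !circ_sub.
have [/subsetPn[e eE eZ]|] := boolP (~~ (ground M \subset C1 :|: C2 :|: D)).
  move: eZ; rewrite !inE !negb_or => /andP[/andP[e1 e2] eD].
  apply: (reduce (delete M e)).
  - exact: delete_matroid.
  - by rewrite /= [X in _ < X](cardsD1 e) eE.
  - by move=> N; apply: sm_del.
  by exists C1, C2, D; split=> //; [apply: skew_pair_delete|rewrite inE dD].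
rewrite negbK => sMZ.
have gr : ground M = C1 :|: C2 :|: D by apply/eqP; rewrite eqEsubset sMZ.
(* Every element lies in a circuit, so pairs in series are genuine cocircuits. *)
have inC x : x \in ground M -> exists2 C, C \in circ M & x \in C.
  by rewrite gr !inE -orbA => /or3P[] xC; [exists C1|exists C2|exists D].
have [/existsP[f /existsP[g /andP[fE ser]]]|noser] :=
    boolP [exists f, exists g, (f \in ground M) && in_series M f g].
  have [ne serC] := in_seriesP _ _ _ ser; have [C cC fC] := inC f fE.
  apply: (reduce (contract M [set f])).
  - exact: contract_series_matroid ser.
  - by rewrite /= [X in _ < X](cardsD1 f) fE.
  - by move=> N; apply: sm_scon ne _; apply: in_series_cocircuit cC fC.
  have meetf E : E \in circ M -> D :&: E != set0 -> (D :\ f) :&: (E :\ f) != set0.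
    move=> cE /set0Pn[z]; rewrite inE => /andP[zD zE]; apply/set0Pn.
    have [zf|nez] := eqVneq z f; last by exists z; rewrite !inE nez zD.
    by exists g; rewrite !inE eq_sym ne -!serC // -zf zD zE.
  exists (C1 :\ f), (C2 :\ f), (D :\ f); split; try exact: meetf.
    exact/(contract_series_skew_pair mM ser).
  by apply/(contract_seriesP _ mM ser); exists D.
have th : theta M C1 C2 (D :\: (C1 :|: C2)).
  by apply: theta_of_minimal => // C cC n1 n2; apply: minD; rewrite /P cC n1.
have noser' f g : f \in ground M -> ~~ in_series M f g.
  move=> fE; apply: contra noser => ser.
  by apply/existsP; exists f; apply/existsP; exists g; rewrite fE.
have [p [p1 p2 grp circP]] := theta_cosimple mM th noser' dD (subsetDl _ _).
have card2 C : C \in circ M -> D != C -> D :&: C != set0 -> 1 < #|C|.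
  move=> cC neD /set0Pn[x]; rewrite inE => /andP[xD xC].
  have [y yC yD] : exists2 y, y \in C & y \notin D.
    by apply: circ_diff mM cC dD _; rewrite eq_sym.
  have ne : x != y by apply: contraNneq yD => <-.
  apply: leq_trans (subset_leq_card (_ : [set x; y] \subset C)).
    by rewrite cards2 ne.
  by rewrite subUset !sub1set xC.
have [ne1 ne2] := theta_neq th (subsetDl _ _).
(* Each uniform part has ground set [C1] or [C2] plus the basepoint. Since [D] meets both circuits
   and contains neither, each has at least two elements, whence the bound 3. *)
exists #|C1|.+1, #|C2|.+1, ord0, ord0, M; split.
- by rewrite ltnS card2.
- by rewrite ltnS card2.
- exact: sm_refl.
by apply: (theta_isomorphic dis p1 p2 _ _ grp circP); apply: card2.
Qed.

End SeriesConnection.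

Theorem theorem1p1 (T : finType) (M : mat T) :
  is_matroid M -> connected M ->
  [<-> SSCE M;
       ~ has_skew_circuits M;
       forall (k l : nat), 3 <= k -> 3 <= l ->
         forall (p1 : 'I_k) (p2 : 'I_l),
           ~ exists N : mat T, series_minor N M /\
               isomorphic N (series_conn (uniform (k - 2) k) (uniform (l - 2) l) p1 p2);
       unbreakable (dual M)].
Proof.
move=> mM conM; have skP := skew_circuits_pair mM.
tfae.
- move=> ssce /skP[C1 [C2]]; exact: SSCE_no_skew.
- move=> nosk k l k3 l3 p1 p2 [N [minorN isoN]]; apply/nosk/skP.
  have [mN lift] := series_minor_skew_pair minorN mM; apply: lift.
  have sk := series_uniform_skew p1 p2 (ltnW k3) (ltnW l3).
  apply: isomorphic_skew_pair isoN _ _ sk.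
  + by move=> C; apply: circ_sub.
  + by apply: subset_trans (subsetUl _ _); apply: imsetS; apply: subsetT.
  by apply: subset_trans (subsetUr _ _); apply: imsetS; apply: subsetT.
(* A skew pair would produce a forbidden series minor; connectedness supplies the circuit meeting
   both of its members. *)
- move=> nominor; apply: no_skew_unbreakable => // C1 C2 sk.
  have [c1 c2 dis _] := sk.
  have [x1 x1C] := circ_nonempty mM c1; have [x2 x2C] := circ_nonempty mM c2.
  have ne12 : x1 != x2 by apply: contraTneq x1C => ->; rewrite (disjointFl dis).
  have [D dD /andP[x1D x2D]] := conM x1 x2 (subsetP (circ_sub mM c1) x1 x1C)
    (subsetP (circ_sub mM c2) x2 x2C) ne12.
  have [|| k [l [p1 [p2 [N [k3 l3 minorN isoN]]]]]] :=
    series_minor_of_skew_pair mM sk dD.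
  + by apply/set0Pn; exists x1; rewrite inE x1D.
  + by apply/set0Pn; exists x2; rewrite inE x2D.
  by case: (nominor k l k3 l3 p1 p2); exists N.
move=> unb; apply: no_skew_SSCE => // C1 C2.
exact: unbreakable_no_skew.
Qed.
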